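(* Let $p\in[1,\infty]$. There exists a constant $K=K(p)>0$, depending only on $p$, such that the following holds. Let $C_0>0$, let $W,V:\mathbb{R}\to\mathbb{C}$ satisfy $$\sup_{x\in\mathbb{R}}|\partial_x^n W(x)|\le C_0^{n},\qquad \sup_{x\in\mathbb{R}}|\partial_x^n V(x)|\le C_0^{n},\qquad \forall n\in\mathbb{N}_0,$$ and let $u\in L^p(\mathbb{R})$ be a solution of $$\partial_x^2 u = W(x)\,\partial_x u+V(x)\,u,\qquad x\in\mathbb{R},$$ with $\|u\|_{L^p(\mathbb{R})}=1$. Then for any $\kappa>1$, $$\|\partial_x^n u\|_{L^p(\mathbb{R})}\le\left(\kappa C_0+K\left(\frac{1}{\log\kappa}+1\right)\right)^n\frac{n!}{\log^n(n+e)},\qquad\forall n\in\mathbb{N}_0 .$$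
   Context: $\mathbb{N}_0=\{0,1,2,\dots\}$; $\log$ is the natural logarithm and $\log^n(y)=(\log y)^n$. $W,V$ are smooth; functions are complex-valued. The equation is understood in the sense of distributions. *)

(* Defs.v *)
From HB Require Import structures.
From mathcomp Require Import all_boot all_order all_algebra.
From mathcomp Require Import all_classical all_reals all_analysis.
From mathcomp.real_closed Require Import complex.

Set Implicit Arguments.
Unset Strict Implicit.
Unset Printing Implicit Defensive.

Import Order.TTheory GRing.Theory Num.Theory.
Import numFieldNormedType.Exports.

Local Open Scope classical_set_scope.
Local Open Scope ring_scope.
Local Open Scope complex_scope.

Section Defs.
Context {R : realType}.
Implicit Types (f g u a phi : R -> R[i]).

Definition ReF f : R -> R := fun x => complex.Re (f x).
Definition ImF f : R -> R := fun x => complex.Im (f x).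

(* The modulus as an element of R: the norm `|z| of R[i] takes values
   in R[i]. *)
Definition modulus (z : R[i]) : R := ComplexField.Normc.normc z.

(* R[i] is not a normed module over R in the library, so derivatives,
   measurability and integrals of complex-valued functions of a real variable
   are taken componentwise. *)
Definition cderiven (n : nat) f : R -> R[i] :=
  fun x => (derive1n n (ReF f) x) +i* (derive1n n (ImF f) x).

Definition smooth f : Prop :=
  forall (n : nat) (x : R),
    derivable (derive1n n (ReF f)) x 1 /\ derivable (derive1n n (ImF f)) x 1.

Definition cmeasurable f : Prop :=
  measurable_fun [set: R] (ReF f) /\ measurable_fun [set: R] (ImF f).

Definition cintegral f : R[i] :=
  Rintegral lebesgue_measure [set: R] (ReF f) +i*
  Rintegral lebesgue_measure [set: R] (ImF f).

Definition supnorm f : \bar R := ereal_sup (range (fun x => (modulus (f x))%:E)).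

Definition Lpnorm (p : \bar R) f : \bar R :=
  Lnorm lebesgue_measure p (fun x : R => (modulus (f x))%:E).

Definition inLp (p : \bar R) f : Prop :=
  cmeasurable f /\ (Lpnorm p f < +oo)%E.

Definition test_function phi : Prop :=
  smooth phi /\ compact (closure [set x | phi x != 0]).

(* Distributions are represented by functionals of which only the values at
   test functions are meaningful; see [dist_eq]. *)
Definition dist := (R -> R[i]) -> R[i].

Definition dist_eq (S T : dist) : Prop :=
  forall phi, test_function phi -> S phi = T phi.

Definition dist_of f : dist := fun phi => cintegral (fun x => f x * phi x).

Definition dist_derive (T : dist) : dist := fun phi => - T (cderiven 1 phi).

Definition dist_derivn (n : nat) (T : dist) : dist := iter n dist_derive T.

Definition dist_mul a (T : dist) : dist := fun phi => T (fun x => a x * phi x).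

Definition dist_add (S T : dist) : dist := fun phi => S phi + T phi.

Definition dist_solution (W V u : R -> R[i]) : Prop :=
  dist_eq (dist_derivn 2 (dist_of u))
    (dist_add (dist_mul W (dist_derivn 1 (dist_of u)))
              (dist_mul V (dist_of u))).

End Defs.

(* Main.v *)
Require Import Defs.
From HB Require Import structures.
From mathcomp Require Import all_boot all_order all_algebra.
From mathcomp Require Import all_classical all_reals all_analysis.
From mathcomp.real_closed Require Import complex.
From mathcomp Require Import ess_sup_inf measurable_realfun ring lra.

Set Implicit Arguments.
Unset Strict Implicit.
Unset Printing Implicit Defensive.

Import Order.TTheory GRing.Theory Num.Theory.
Import numFieldNormedType.Exports.

Local Open Scope classical_set_scope.
Local Open Scope ring_scope.

(** The estimate follows from an a priori bound on u' and a recurrence for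
    the norms of the derivatives.

    First derivative.  Taylor's formula with integral remainder
      u' = (u (. + h) - u) / h - T u'',
      (T f) (x) = int_0^h (1 - s / h) f (x + s) ds,
    can be read in transposed form, as an identity between test functions
    ([cderiven2_hat]).  Testing the equation with the transpose of T applied to a
    test function then represents u' by an L^p function
    ([solution_weak_derivative]), whose norm depends on C0 because a derivative
    falls on W.  With this function at hand the equation gives u'' = W u' + V u
    as a function, and Taylor's formula represents u' once more; as T has norm
    at most h on L^p ([caverage_inLp], by Young's inequality), the step h = 1/2
    bounds the norm of the new representative by r / 2 + 9 / 2 if r bounds that
    of the old one ([weak_derivative_improve]).  Finitely many repetitions
    yield a representative of norm at most 10, uniformly in C0 ([solution_weak_derivative_bounded]).

    Higher derivatives.  They are defined by Leibniz' rule from the equation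
    ([weak_derivative_leibniz]), so the norms a_n satisfy
      a_(n+2) <= sum_(k <= n) C(n, k) C0^(n-k) (a_(k+1) + a_k).

    Growth.  The exponential generating function M of a_k + a_(k+1) satisfies
    M' <= (1 + exp(B t)) M for every B >= C0, hence
    M(r) <= M(0) exp(r + (exp(B r) - 1) / B) by Gronwall's lemma
    ([egf_gronwall]).  At r = log(n + e) / B the inner exponential is n + e, so
    the right-hand side is exp(O(n / B)), and Cauchy's estimate bounds a_n by
    n! (B / log(n + e))^n times that factor.  Taking B smaller than the constant
    of the theorem by the factor min(kappa, e), the power min(kappa, e)^n pays
    for it as soon as B log(min(kappa, e)) is large, which is what the term
    K / log kappa is for ([growth_estimate]). *)

(** * Sequences with an exponential convolution recurrence *)

Lemma partial_sum_le_expR (R : realType) (x : R) (n : nat) :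
  0 <= x -> \sum_(i < n) x ^+ i / i`!%:R <= expR x.
Proof.
move=> x0.
have -> : \sum_(i < n) x ^+ i / i`!%:R = series (exp_coeff x) n.
  by rewrite /series /= big_mkord; apply: eq_bigr => i _.
apply: nondecreasing_cvgn_le; last exact: is_cvg_series_exp_coeff.
by apply: nondecreasing_series => i _ _; exact: exp_coeff_ge0.
Qed.

(** A truncation of the exponential generating function of [m]. *)
Definition egf_partial (R : realType) (m : nat -> R) (N : nat) (t : R) : R :=
  \sum_(k < N) m k * (t ^+ k / k`!%:R).

Lemma egf_partial_le (R : realType) (m : nat -> R) (N N' : nat) (t : R) :
  (forall k, 0 <= m k) -> 0 <= t -> (N <= N')%N ->
  egf_partial m N t <= egf_partial m N' t.
Proof.
move=> m0 t0 NN'; rewrite /egf_partial.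
rewrite (big_ord_widen_cond _ xpredT (fun k => m k * (t ^+ k / k`!%:R)) NN').
rewrite [leRHS](bigID (fun k : 'I_N' => (k < N)%N)) /= lerDl.
by apply: sumr_ge0 => i _; rewrite mulr_ge0 ?divr_ge0 ?exprn_ge0.
Qed.

(** The binomial convolution of [m] with the powers of [B] has the product of
    [expR (B * t)] with the generating function of [m] as its generating
    function; since everything is nonnegative, truncating costs an inequality
    only. *)
Lemma egf_convolution_le (R : realType) (m : nat -> R) (B t : R) (N : nat) :
  (forall k, 0 <= m k) -> 0 <= B -> 0 <= t ->
  \sum_(k < N) (\sum_(j < k.+1) 'C(k, j)%:R * B ^+ (k - j) * m j)
     * (t ^+ k / k`!%:R)
    <= expR (B * t) * egf_partial m N t.
Proof.
move=> m0 B0 t0.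
have -> : \sum_(k < N) (\sum_(j < k.+1) 'C(k, j)%:R * B ^+ (k - j) * m j)
     * (t ^+ k / k`!%:R) =
   \sum_(k < N) \sum_(j < N | (j <= k)%N)
     m j * (t ^+ j / j`!%:R) * ((B * t) ^+ (k - j) / (k - j)`!%:R).
  apply: eq_bigr => k _; rewrite big_distrl /=.
  rewrite (big_ord_widen _ (fun j => 'C(k, j)%:R * B ^+ (k - j) * m j *
    (t ^+ k / k`!%:R)) (ltn_ord k)).
  apply: eq_big => [j|j jk]; first by rewrite ltnS.
  have {}jk : (j <= k)%N by rewrite -ltnS.
  have -> : t ^+ k = t ^+ j * t ^+ (k - j) by rewrite -exprD subnKC.
  rewrite exprMn.
  have kE : k`!%:R = 'C(k, j)%:R * (j`!%:R * (k - j)`!%:R) :> R.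
    by rewrite -!natrM bin_fact.
  rewrite kE.
  have c0 : 'C(k, j)%:R != 0 :> R by rewrite pnatr_eq0 -lt0n bin_gt0.
  have j0 : j`!%:R != 0 :> R by rewrite pnatr_eq0 -lt0n fact_gt0.
  have kj0 : (k - j)`!%:R != 0 :> R by rewrite pnatr_eq0 -lt0n fact_gt0.
  by field; rewrite c0 j0 kj0.
rewrite (exchange_big_dep xpredT) //= [leRHS]mulrC [leRHS]big_distrl /=.
apply: ler_sum => j _; rewrite -big_distrr /=.
apply: ler_wpM2l; first by rewrite mulr_ge0 ?divr_ge0 ?exprn_ge0.
apply: le_trans (@partial_sum_le_expR _ (B * t) (N - j) _); last exact: mulr_ge0.
rewrite -(big_geq_mkord _ _ xpredT
  (fun k => (B * t) ^+ (k - j) / (k - j)`!%:R)) -{1}[j : nat]add0n big_addn.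
rewrite big_mkord.
by apply: ler_sum => i _; rewrite addnK.
Qed.

Lemma egf_partial_derive (R : realType) (m : nat -> R) (N : nat) (t : R) :
  is_derive t 1 (egf_partial m N.+1) (egf_partial (fun k => m k.+1) N t).
Proof.
pose p : {poly R} := \sum_(k < N.+1) (m k / k`!%:R) *: 'X^k.
have pE : egf_partial m N.+1 = horner p.
  apply/funext => x; rewrite /egf_partial /p horner_sum; apply: eq_bigr => k _.
  by rewrite hornerZ hornerXn mulrAC mulrA.
rewrite pE; apply: DeriveDef; first exact: derivable_horner.
rewrite -derive1E -derivE /p raddf_sum horner_sum big_ord_recl /=.
rewrite expr0 derivZ derivC scaler0 horner0 add0r; apply: eq_bigr => k _.
rewrite derivZ derivXn hornerZ hornerMn hornerXn /bump /= add1n.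
rewrite factS natrM -[_ ^+ _ *+ _]mulr_natr add0n.
have k0 : k.+1%:R != 0 :> R by rewrite pnatr_eq0.
have f0 : k`!%:R != 0 :> R by rewrite pnatr_eq0 -lt0n fact_gt0.
move: (k.+1%:R : R) (k`!%:R : R) k0 f0 => a b a0 b0.
by field; rewrite a0 b0.
Qed.

(** The recurrence reads M' <= (1 + exp(B t)) M for the generating function M, so
    M(t) exp(- t - (exp(B t) - 1) / B) does not increase on t >= 0. *)
Lemma egf_gronwall (R : realType) (m : nat -> R) (B r : R) (N : nat) :
  (forall k, 0 <= m k) -> 0 < B -> 0 <= r ->
  (forall k, m k.+1 <=
     m k + \sum_(j < k.+1) 'C(k, j)%:R * B ^+ (k - j) * m j) ->
  egf_partial m N.+1 r <= m 0%N * expR (r + (expR (B * r) - 1) / B).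
Proof.
move=> m0 B0 r0 mS.
pose G (t : R) : R := t + (expR (B * t) - 1) / B.
pose g (t : R) : R := egf_partial m N.+1 t * expR (- G t).
have dG (t : R) : is_derive t 1 G (1 + expR (B * t)).
  rewrite /G; apply: is_derive_eq.
  rewrite /GRing.scale /=; field; exact: lt0r_neq0.
have dg (t : R) : is_derive t 1 g
    ((egf_partial (fun k => m k.+1) N t
       - (1 + expR (B * t)) * egf_partial m N.+1 t) * expR (- G t)).
  have dM := egf_partial_derive m N t.
  rewrite /g; apply: is_derive_eq.
  rewrite /GRing.scale /=; ring.
have gr : g r <= g 0.
  apply: (@ler0_derive1_nincr _ g 0 r) => //.
  - move=> x; rewrite in_itv /= => /andP[x0 _].
    rewrite derive1E derive_val pmulr_lle0 ?expR_gt0// subr_le0 mulrDl mul1r.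
    apply: (@le_trans _ _ (\sum_(k < N) (m k + \sum_(j < k.+1)
       'C(k, j)%:R * B ^+ (k - j) * m j) * (x ^+ k / k`!%:R))).
      apply: ler_sum => k _; apply: ler_wpM2r => //.
      by rewrite divr_ge0 ?exprn_ge0 ?ltW.
    under eq_bigr do rewrite mulrDl.
    rewrite big_split /=; apply: lerD.
      by apply: egf_partial_le => //; exact: ltW.
    apply: le_trans (egf_convolution_le _ m0 (ltW B0) (ltW x0)) _.
    rewrite ler_wpM2l ?expR_ge0//.
    by apply: egf_partial_le => //; exact: ltW.
  - apply: derivable_within_continuous => x _.
    by have [] := dg x.
have G0 : G 0 = 0 by rewrite /G mulr0 expR0 subrr mul0r addr0.
move: gr; rewrite /g G0 oppr0 expR0 mulr1 expRN ler_pdivrMr ?expR_gt0// => /le_trans.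
apply; rewrite ler_wpM2r ?expR_ge0//.
rewrite /egf_partial big_ord_recl big1 ?addr0 => [|i _]; last first.
  by rewrite lift0 expr0n /= mul0r mulr0.
by rewrite expr0 divr1 mulr1.
Qed.

Lemma expR1_le4 (R : realType) : expR 1 <= 4 :> R.
Proof.
have h : expR 2^-1 <= 2 :> R.
  have := @expR_ge1Dx R (- 2^-1); rewrite expRN => h.
  have h2 : 2^-1 <= (expR 2^-1)^-1 :> R by apply: le_trans h; lra.
  by rewrite lef_pV2 ?posrE ?expR_gt0 in h2.
have -> : 1 = 2^-1 + 2^-1 :> R by lra.
by rewrite expRD; have := expR_gt0 (2^-1 : R); nra.
Qed.

Lemma sqr_le_expR (R : realType) (x : R) : 0 <= x -> x ^+ 2 <= 4 * expR x.
Proof.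
move=> x0; have {2}-> : x = x / 2 + x / 2 by lra.
rewrite expRD; have := @expR_ge1Dx R (x / 2).
have := expR_gt0 (x / 2); nra.
Qed.

Lemma ln_nat_ge1 (R : realType) (n : nat) : 1 <= ln (n%:R + expR 1) :> R.
Proof.
by rewrite -{1}(expRK (1 : R)) ler_ln ?posrE ?expR_gt0 ?lerDr//
  ltr_wpDl ?expR_gt0.
Qed.

(** The coefficient of index [N] of the differential inequality behind the
    recurrence, estimated at the radius r = ln (N + 2 + e) / B.  This radius
    turns exp(B r) into N + 2 + e, so the double exponential of Gronwall's lemma
    is at most exp(2 (N + 1 + e) / B), which the factor exp(lam (N + 2)) absorbs
    because 1 / B <= lam / 30.  The remaining factor 11 r^2 exp(B r) is quadratic
    in N and is absorbed by the quotient (N + 2)! / N!. *)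
Lemma growth_core (R : realType) (a : nat -> R) (B lam : R) (N : nat) :
  (forall n, 0 <= a n) -> a 0%N + a 1%N <= 11 ->
  0 < lam -> lam <= 1 -> 30 <= B * lam ->
  (forall n, a n.+2 <=
     \sum_(k < n.+1) 'C(n, k)%:R * B ^+ (n - k) * (a k.+1 + a k)) ->
  a N.+2 <= (expR lam * B) ^+ N.+2 *
    (N.+2`!%:R / ln (N.+2%:R + expR 1) ^+ N.+2).
Proof.
move=> a0 a01 l0 l1 Bl aS.
have B0 : 0 < B by nra.
have B30 : 30 <= B by nra.
set E : R := N.+2%:R + expR 1.
have E0 : 0 < E by rewrite /E ltr_wpDl ?expR_gt0.
set L := ln E.
have L1 : 1 <= L by exact: ln_nat_ge1.
have expL : expR L = E by rewrite /L lnK // posrE.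
pose r := L / B.
have r0 : 0 <= r by rewrite /r divr_ge0 ?ltW// (lt_le_trans _ L1).
have Br : B * r = L by rewrite /r mulrCA divff ?mulr1// gt_eqF.
pose m k := a k.+1 + a k.
have m0 k : 0 <= m k by rewrite addr_ge0.
have mS k : m k.+1 <=
    m k + \sum_(j < k.+1) 'C(k, j)%:R * B ^+ (k - j) * m j.
  by rewrite /m addrC lerD // lerDl.
have N0 : 0 <= N%:R :> R by exact: ler0n.
have N2 : N.+2%:R = N%:R + 2 :> R by rewrite -addn2 natrD.
have E6 : E <= N%:R + 6.
  by rewrite /E N2; have := @expR1_le4 R; lra.
have LE : L <= E - 1.
  rewrite /L; have {1}-> : E = 1 + (E - 1) by lra.
  by apply: le_ln1Dx; lra.
have expo : r + (expR (B * r) - 1) / B <= N.+2%:R * lam.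
  rewrite Br expL /r -mulrDl ler_pdivrMr// N2.
  by nra.
have step : a N.+2 * (r ^+ N / N`!%:R) <= E * (11 * expR lam ^+ N.+2).
  apply: (@le_trans _ _ (expR (B * r) * egf_partial m N.+1 r)).
    apply: le_trans (egf_convolution_le N.+1 m0 (ltW B0) r0).
    rewrite big_ord_recr /=.
    apply: ler_wpDl.
      apply: sumr_ge0 => i _; apply: mulr_ge0; last by rewrite divr_ge0 ?exprn_ge0.
      by apply: sumr_ge0 => j _; rewrite !mulr_ge0 ?exprn_ge0 ?(ltW B0).
    by apply: ler_wpM2r => //; rewrite divr_ge0 ?exprn_ge0.
  rewrite Br expL; apply: ler_wpM2l; first exact: ltW.
  apply: le_trans (egf_gronwall _ m0 B0 r0 mS) _.
  apply: ler_pM => //.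
    by rewrite /m addrC.
  by rewrite -expRM_natl ler_expR.
have f0 : 0 < N`!%:R :> R by rewrite ltr0n fact_gt0.
have r2 : r ^+ 2 * (11 * E) <= N.+2%:R * N.+1%:R.
  have rB : r <= L / 30.
    by rewrite /r ler_wpM2l ?(le_trans _ L1)// lef_pV2 ?posrE.
  have rr : r ^+ 2 <= (L / 30) ^+ 2 by rewrite lerXn2r ?nnegrE //; lra.
  have LL : L ^+ 2 <= 4 * E by rewrite -expL; apply: sqr_le_expR; lra.
  have rrE : r ^+ 2 <= E / 225 by apply: le_trans rr _; nra.
  rewrite N2 (_ : N.+1%:R = N%:R + 1); last by rewrite -addn1 natrD.
  apply: (@le_trans _ _ (E / 225 * (11 * E))).
    by apply: ler_wpM2r => //; lra.
  by nra.
rewrite [leRHS]mulrA ler_pdivlMr ?exprn_gt0 ?(lt_le_trans _ L1)//.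
suff key : a N.+2 * r ^+ N.+2 <= expR lam ^+ N.+2 * N.+2`!%:R.
  have -> : a N.+2 * L ^+ N.+2 = B ^+ N.+2 * (a N.+2 * r ^+ N.+2).
    by rewrite -Br exprMn; ring.
  have -> : (expR lam * B) ^+ N.+2 * N.+2`!%:R =
      B ^+ N.+2 * (expR lam ^+ N.+2 * N.+2`!%:R).
    by rewrite exprMn; ring.
  by apply: ler_wpM2l => //; rewrite exprn_ge0 ?ltW.
have -> : N.+2`!%:R = N.+2%:R * N.+1%:R * N`!%:R :> R.
  by rewrite !factS !natrM mulrA.
have -> : a N.+2 * r ^+ N.+2 = (a N.+2 * (r ^+ N / N`!%:R)) * (r ^+ 2 * N`!%:R).
  have -> : r ^+ N.+2 = r ^+ N * r ^+ 2 by rewrite -exprD addn2.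
  move: (N`!%:R : R) f0 => b b0.
  by field; exact: lt0r_neq0.
apply: (@le_trans _ _ (E * (11 * expR lam ^+ N.+2) * (r ^+ 2 * N`!%:R))).
  by apply: ler_wpM2r => //; rewrite mulr_ge0 ?exprn_ge0.
have -> : E * (11 * expR lam ^+ N.+2) * (r ^+ 2 * N`!%:R) =
   (r ^+ 2 * (11 * E)) * (N`!%:R * expR lam ^+ N.+2) by ring.
have -> : expR lam ^+ N.+2 * (N.+2%:R * N.+1%:R * N`!%:R) =
   (N.+2%:R * N.+1%:R) * (N`!%:R * expR lam ^+ N.+2) by ring.
by apply: ler_wpM2r => //; rewrite mulr_ge0 ?exprn_ge0 ?expR_ge0.
Qed.

(** Raising the constant of the recurrence from [C0] to
    B = A / min(kappa, e), where A is the base of the power in the conclusion,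
    keeps the recurrence true since A >= kappa C0, and leaves the factor
    min(kappa, e) ^ n to spend.  The term K / ln kappa of A ensures that
    B ln (min(kappa, e)) >= 30. *)
Lemma growth_estimate (R : realType) (C0 kappa : R) (a : nat -> R) :
  0 < C0 -> 1 < kappa ->
  (forall n, 0 <= a n) -> a 0%N <= 1 -> a 1%N <= 10 ->
  (forall n, a n.+2 <=
     \sum_(k < n.+1) 'C(n, k)%:R * C0 ^+ (n - k) * (a k.+1 + a k)) ->
  forall n, a n <= (kappa * C0 + 30 * expR 1 * (1 / ln kappa + 1)) ^+ n *
    (n`!%:R / ln (n%:R + expR 1) ^+ n).
Proof.
move=> C00 k1 a0 a0le a1le aS.
have lk0 : 0 < ln kappa by rewrite ln_gt0.
set A := kappa * C0 + _.
have ilk : 0 < (ln kappa)^-1 by rewrite invr_gt0.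
have e1 : 1 <= expR 1 :> R by have := @expR_ge1Dx R 1; lra.
have A30 : 30 * expR 1 <= A.
  by rewrite /A div1r; nra.
case=> [|[|N]].
- by rewrite !expr0 fact0 divr1 mulr1.
- rewrite !expr1.
  have L0 : 0 < ln (1 + expR 1) :> R.
    by rewrite (lt_le_trans _ (ln_nat_ge1 R 1)).
  change (a 1%N <= A * (1 / ln (1 + expR 1))).
  rewrite div1r ler_pdivlMr//.
  have Le : ln (1 + expR 1) <= expR 1 :> R by apply: le_ln1Dx; lra.
  have := a0 1%N; nra.
(* Capping the exponent at 1 keeps expR lam, by which A is divided, bounded. *)
pose lam := Num.min (ln kappa) 1.
have lam0 : 0 < lam by rewrite /lam lt_min lk0 ltr01.
have lam1 : lam <= 1 by rewrite /lam ge_min lexx orbT.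
have laml : lam <= ln kappa by rewrite /lam ge_min lexx.
have elk : expR lam <= kappa.
  by rewrite -[leRHS](@lnK _ kappa) ?posrE ?ler_expR//; lra.
have ele : expR lam <= expR 1 by rewrite ler_expR.
pose B := A / expR lam.
have el0 := expR_gt0 lam.
have AE : A = expR lam * B by rewrite /B mulrCA divff ?mulr1 ?gt_eqF.
have CB : C0 <= B.
  rewrite /B ler_pdivlMr// /A.
  by rewrite div1r; nra.
have lamA : 1 <= lam * (1 / ln kappa + 1).
  rewrite /lam div1r; have [h|h] := leP (ln kappa) 1.
    by rewrite mulrDr divff ?gt_eqF// mulr1; lra.
  by rewrite mul1r; lra.
have Bl : 30 <= B * lam.
  rewrite /B mulrAC ler_pdivlMr// /A.
  have h1 : 0 <= kappa * (C0 * lam) by rewrite !mulr_ge0 ?ltW// (lt_trans ltr01).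
  have h2 : 30 * expR 1 <= 30 * expR 1 * (lam * (1 / ln kappa + 1)).
    by rewrite ler_peMr// mulr_ge0 ?expR_ge0.
  have -> : (kappa * C0 + 30 * expR 1 * (1 / ln kappa + 1)) * lam =
      kappa * (C0 * lam) + 30 * expR 1 * (lam * (1 / ln kappa + 1)) by ring.
  lra.
rewrite AE; apply: growth_core => //; first lra.
move=> n; apply: le_trans (aS n) _; apply: ler_sum => k _.
apply: ler_wpM2r; first exact: addr_ge0.
apply: ler_wpM2l => //; rewrite lerXn2r ?nnegrE //; lra.
Qed.

(** * Translation invariance of the Lebesgue integral *)

Section translation.
Context {R : realType}.
Local Notation mu := (@lebesgue_measure R).
Local Open Scope ereal_scope.

Lemma measurable_shift (a : R) : measurable_fun [set: R] (fun x : R => (x + a)%R).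
Proof. by apply: measurable_funD => //; exact: measurable_cst. Qed.

(** Both sides are measures in [A], and they agree on half-open intervals. *)
Lemma lebesgue_measure_shift (a : R) (A : set (measurableTypeR R)) :
  measurable A -> mu ((fun x : R => (x + a)%R) @^-1` A) = mu A.
Proof.
move=> mA; apply/esym.
have ms : measurable_fun [set: measurableTypeR R]
    ((fun x => (x + a)%R) : measurableTypeR R -> measurableTypeR R).
  exact: measurable_shift.
pose nu : {measure set (measurableTypeR R) -> \bar R} := 
  measure_function_pushforward__canonical__measure_function_Measure mu ms.
apply: (@lebesgue_measure_unique _ nu) => // _ [[b c] _ <-] /=.
rewrite /pushforward.
have -> : (fun x : R => (x + a)%R) @^-1` `]b, c] = `](b - a)%R, (c - a)%R]%classic.
  by apply/seteqP; split => x /=; rewrite !in_itv /= ltrBlDr lerBrDr.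
rewrite !lebesgue_measure_itv /= !lte_fin ltrD2r; case: ifP => // _.
rewrite -!EFinB; congr (_%:E); ring.
Qed.

Lemma ge0_integral_shift (a : R) (f : R -> \bar R) :
  measurable_fun [set: R] f -> (forall x, 0 <= f x) ->
  \int[mu]_x f (x + a)%R = \int[mu]_x f x.
Proof.
move=> mf f0.
have ms : measurable_fun [set: measurableTypeR R]
    ((fun x => (x + a)%R) : measurableTypeR R -> measurableTypeR R).
  exact: measurable_shift.
have := @ge0_integral_pushforward _ _ _ _ R _ ms mu setT f measurableT mf
  (fun y _ => f0 y).
rewrite preimage_setT => <-.
apply: eq_measure_integral => A mA _.
exact: (@lebesgue_measure_shift a A mA).
Qed.

(** The positive and negative parts are shifted separately, so the equality holds
    for every measurable function, with the same convention for undefined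
    integrals on both sides. *)
Lemma integral_shift (a : R) (f : R -> \bar R) :
  measurable_fun [set: R] f ->
  \int[mu]_x f (x + a)%R = \int[mu]_x f x.
Proof.
move=> mf; rewrite integralE [RHS]integralE; congr (_ - _).
  rewrite -[RHS](@ge0_integral_shift a) //; last exact: measurable_funepos.
  by apply: eq_integral => x _; rewrite !funeposE.
rewrite -[RHS](@ge0_integral_shift a) //; last exact: measurable_funeneg.
by apply: eq_integral => x _; rewrite !funenegE.
Qed.

End translation.

(** * Averages over a window and their transposes *)

Section averaging.
Context {R : realType}.
Local Notation mu := (@lebesgue_measure R).
Implicit Types (f g k psi : R -> R).

Definition kernel_on (h : R) k :=
  measurable_fun [set: R] k /\ forall s, `|k s| <= \1_(`[0, h] : set R) s.

Definition average k f : R -> R := fun x => \int[mu]_s (k s * f (x + s)).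

(** The transpose of [average] for the pairing of [f] and [psi] by the integral of
    their product; see [average_duality]. *)
Definition co_average k f : R -> R := fun x => \int[mu]_s (k s * f (x - s)).

(** The cut-off is a factor of the integrand so that all integrals range over the
    whole line, as in Fubini's theorem. *)
Definition locally_summable f := measurable_fun [set: R] f /\
  forall N : R, mu.-integrable [set: R]
    (EFin \o (fun x => f x * \1_(`[- N, N] : set R) x)).

Lemma measurable_addr (x : R) : measurable_fun [set: R] (fun s : R => x + s).
Proof. by apply: measurable_funD => //; exact: measurable_cst. Qed.

Lemma measurable_fun_shift (a : R) f : measurable_fun [set: R] f ->
  measurable_fun [set: R] (fun x => f (x + a)).
Proof. by move=> mf; apply: measurableT_comp => //; exact: measurable_shift. Qed.

Lemma integrable_shift (a : R) f : mu.-integrable [set: R] (EFin \o f) ->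
  mu.-integrable [set: R] (EFin \o (fun x => f (x + a))).
Proof.
move=> /integrableP[mf fi]; apply/integrableP; split.
  apply/measurable_EFinP; apply: measurable_fun_shift.
  by move/measurable_EFinP : mf.
apply: le_lt_trans fi; rewrite le_eqVlt; apply/orP; left; apply/eqP.
apply: (@ge0_integral_shift _ a (fun x => `|(f x)%:E|)%E) => //.
exact: measurableT_comp.
Qed.

(** The integrals over [s] may diverge, so Tonelli's theorem is applied to the
    positive and the negative part separately. *)
Lemma measurable_average k f :
  measurable_fun [set: R] k -> measurable_fun [set: R] f ->
  measurable_fun [set: R] (average k f).
Proof.
move=> mk mf.
pose H (z : measurableTypeR R * measurableTypeR R) := (k z.2 * f (z.1 + z.2))%:E.
have mH : measurable_fun [set: measurableTypeR R * measurableTypeR R] H.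
  apply/measurable_EFinP; apply: measurable_funM.
    by apply: measurableT_comp => //; exact: measurable_snd.
  apply: measurableT_comp => //; apply: measurable_funD.
    exact: measurable_fst.
  exact: measurable_snd.
have -> : average k f = fine \o
    (fun x => fubini_F mu (H^\+)%E x - fubini_F mu (H^\-)%E x)%E.
  apply/funext => x; rewrite /average /Rintegral /fubini_F /= integralE.
  congr (fine (_ - _)).
  - by apply: eq_integral => s _; rewrite !funeposE.
  - by apply: eq_integral => s _; rewrite !funenegE.
apply: measurableT_comp => //.
apply: emeasurable_funB.
- apply: measurable_fun_fubini_tonelli_F => //; exact: measurable_funepos.
- apply: measurable_fun_fubini_tonelli_F => //; exact: measurable_funeneg.
Qed.

Lemma integrable_indic_itv (a b : R) :
  mu.-integrable [set: R] (EFin \o (\1_(`[a, b] : set R) : R -> R)).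
Proof.
apply/integrableP; split.
  by apply/measurable_EFinP; exact: measurable_indic.
under eq_integral do rewrite /= ger0_norm//.
rewrite integral_indic// setIT.
have : (mu `[a, b]%classic < +oo)%E.
  by rewrite lebesgue_measure_itv /=; case: ifP => // _; rewrite -EFinB ltry.
exact.
Qed.

Lemma integrable_bound f g : measurable_fun [set: R] f ->
  (forall x, `|f x| <= `|g x|) -> mu.-integrable [set: R] (EFin \o g) ->
  mu.-integrable [set: R] (EFin \o f).
Proof.
move=> mf fg; apply: le_integrable => //; first exact/measurable_EFinP.
by move=> x _; rewrite /= lee_fin.
Qed.

Lemma indic_itvE (a b x : R) :
  \1_(`[a, b] : set R) x = ((a <= x) && (x <= b))%:R :> R.
Proof. by rewrite indicE; congr (nat_of_bool _)%:R; rewrite mem_setE in_itv. Qed.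

(** When [s] is in the support of the kernel, [x + s] stays in a fixed bounded
    interval. *)
Lemma average_integrable h k f x : kernel_on h k -> locally_summable f ->
  mu.-integrable [set: R] (EFin \o (fun s => k s * f (x + s))).
Proof.
move=> [mk kle] [mf fi].
pose N := `|x| + `|h|.
apply: (@integrable_bound _
  (fun s => f (s + x) * \1_(`[- N, N] : set R) (s + x))).
- apply: measurable_funM => //.
  by apply: measurableT_comp => //; exact: measurable_addr.
- move=> s; rewrite !normrM [x + s]addrC mulrC.
  rewrite ler_wpM2l//; apply: le_trans (kle s) _.
  rewrite !indic_itvE normr_nat ler_nat /N.
  case: andP => //= -[s0 sh].
  have := ler_norm x; have := ler_norm (- x); rewrite normrN.
  have := ler_norm h => h1 h2 h3.
  by rewrite (_ : _ && _ = true) //; apply/andP; split; lra.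
- exact: integrable_shift (fi _).
Qed.

Definition bounded_support (N C : R) psi :=
  [/\ measurable_fun [set: R] psi, 0 <= C &
      forall x, `|psi x| <= C * \1_(`[- N, N] : set R) x].

Lemma integrableM_bounded_support N C f psi :
  locally_summable f -> bounded_support N C psi ->
  mu.-integrable [set: R] (EFin \o (fun x => f x * psi x)).
Proof.
move=> [mf fi] [mp C0 pC].
apply: (@integrable_bound _ (fun x => C * (f x * \1_(`[- N, N] : set R) x))).
- exact: measurable_funM.
- move=> x; rewrite !normrM mulrCA.
  rewrite ler_wpM2l//; apply: le_trans (pC x) _.
  by rewrite -normrM ler_norm.
- have := integrableZl measurableT C (fi N).
  by apply: eq_integrable => // x _; rewrite /= EFinM.
Qed.

Lemma co_average_integrable h k N C psi x : kernel_on h k ->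
  bounded_support N C psi ->
  mu.-integrable [set: R] (EFin \o (fun s => k s * psi (x - s))).
Proof.
move=> [mk kle] [mp C0 pC].
apply: (@integrable_bound _ (fun s => C * \1_(`[0, h] : set R) s)).
- apply: measurable_funM => //.
  apply: measurableT_comp => //; exact: measurable_funB.
- move=> s; rewrite !normrM mulrC; apply: ler_pM => //.
    apply: le_trans (pC _) _; rewrite ler_normr; apply/orP; left.
    by rewrite ler_piMr// indic_itvE lern1 leq_b1.
  by apply: le_trans (kle s) _; exact: ler_norm.
- have := integrableZl measurableT C (integrable_indic_itv 0 h).
  by apply: eq_integrable => // y _; rewrite /= EFinM.
Qed.

Lemma Rintegral_shift (a : R) f : measurable_fun [set: R] f ->
  \int[mu]_x f (x + a) = \int[mu]_x f x.
Proof.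
move=> mf; congr fine; apply: (@integral_shift _ a (EFin \o f)).
exact/measurable_EFinP.
Qed.

Lemma EFin_Rintegral f : mu.-integrable [set: R] (EFin \o f) ->
  (\int[mu]_x f x)%:E = (\int[mu]_x (f x)%:E)%E.
Proof. by move=> fi; rewrite /Rintegral fineK //; exact: integrable_fin_num. Qed.

(** Fubini's theorem twice: for fixed [s], translating [x] by [s] moves the
    translation from [psi] to [f].  The supports of [k] and [psi] confine [x] to
    a bounded interval, on which [f] is integrable. *)
Lemma average_duality h N C k f psi :
  kernel_on h k -> locally_summable f -> bounded_support N C psi ->
  \int[mu]_x (f x * co_average k psi x) = \int[mu]_x (average k f x * psi x).
Proof.
move=> kh fs ps; have [mk kle] := kh; have [mf fi] := fs.
have [mp C0 pC] := ps.
pose T := (measurableTypeR R * measurableTypeR R)%type.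
pose H (z : T) := (f z.1 * (k z.2 * psi (z.1 - z.2)))%:E.
pose H' (z : T) := (k z.2 * f (z.1 + z.2) * psi z.1)%:E.
have mH : measurable_fun [set: T] H.
  apply/measurable_EFinP; apply: measurable_funM.
    by apply: measurableT_comp => //; exact: measurable_fst.
  apply: measurable_funM.
    by apply: measurableT_comp => //; exact: measurable_snd.
  apply: measurableT_comp => //; apply: measurable_funB.
    exact: measurable_fst.
  exact: measurable_snd.
have mH' : measurable_fun [set: T] H'.
  apply/measurable_EFinP; apply: measurable_funM; last first.
    by apply: measurableT_comp => //; exact: measurable_fst.
  apply: measurable_funM.
    by apply: measurableT_comp => //; exact: measurable_snd.
  apply: measurableT_comp => //; apply: measurable_funD.
    exact: measurable_fst.
  exact: measurable_snd.
pose N' := `|N| + `|h|.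
have mH1 s : measurable_fun [set: R] (fun x => H (x, s)).
  apply: (measurableT_comp mH); exact: measurable_pair2.
have Hshift s (F : \bar R -> \bar R) :
    (\int[mu]_x F (H (x + s, s)%R) = \int[mu]_x F (H' (x, s)))%E.
  by apply: eq_integral => x _; rewrite /H /H' /= addrK mulrA [f _ * _]mulrC.
have Hle x s : (`|H (x, s)| <=
   (C * `|f x * \1_(`[- N', N'] : set R) x| * \1_(`[0%R, h] : set R) s)%:E)%E.
  rewrite /H /= lee_fin !normrM [X in _ <= _ * (_ * X) * _]ger0_norm//.
  have kx := kle s; have px := pC (x - s).
  have [s0|s0] := boolP ((0 <= s) && (s <= h)); last first.
    move: kx; rewrite indic_itvE (negbTE s0) normr_le0 => /eqP ->.
    by rewrite normr0 mul0r !mulr0.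
  have [s1|s1] := boolP ((- N <= x - s) && (x - s <= N)); last first.
    move: px; rewrite indic_itvE (negbTE s1) mulr0 normr_le0 => /eqP ->.
    rewrite normr0 !mulr0; do !apply: mulr_ge0 => //.
  rewrite !indic_itvE s0 (_ : (- N' <= x) && (x <= N') = true) ?mulr1; last first.
    rewrite /N'; move/andP: s0 => [? ?]; move/andP: s1 => [? ?].
    have := ler_norm N; have := ler_norm h.
    by move=> ? ?; apply/andP; split; lra.
  rewrite mulrC ler_wpM2r//.
  move: kx px; rewrite !indic_itvE s0 s1 mulr1 => kx px.
  by rewrite -[leRHS]mul1r ler_pM.
have iH : (mu \x mu)%E.-integrable [set: T] H.
  apply/integrable12ltyP => //.
  pose G x := C * `|f x * \1_(`[- N', N'] : set R) x|.
  have G0 x : 0 <= G x by rewrite mulr_ge0.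
  have iG : mu.-integrable [set: R] (EFin \o G).
    have := integrableZl measurableT C (integrable_abse (fi N')).
    by apply: eq_integrable => // x _; rewrite /= EFinM.
  have m1 : (mu `[0%R, h]%classic < +oo)%E.
    by rewrite lebesgue_measure_itv /=; case: ifP => // _; rewrite -EFinB ltry.
  pose c := fine (mu `[0%R, h]%classic).
  have cE : mu `[0%R, h]%classic = c%:E.
    by rewrite /c fineK // ge0_fin_numE.
  have := integrable_lty measurableT (integrableZl measurableT c iG).
  apply: le_lt_trans; apply: ge0_le_integral => //.
  - by move=> x _; apply: integral_ge0.
  - apply: (measurable_fun_fubini_tonelli_F (fun z => `|H z|)%E) => //.
    exact: measurableT_comp.
  - exact: measurable_int (integrableZl measurableT c iG).
  - move=> x _; apply: le_trans.
      apply: ge0_le_integral => //; last by move=> s _; exact: (Hle x s).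
      + apply: measurableT_comp => //.
        apply: (measurableT_comp mH); exact: measurable_pair1.
      + by apply/measurable_EFinP; exact: measurable_funM.
    rewrite -/(G x); under eq_integral do rewrite EFinM.
    rewrite ge0_integralZl//; last by rewrite lee_fin.
      2: exact/measurable_EFinP.
    rewrite integral_indic// setIT /= muleC cE.
    exact: lexx.
have iH' : (mu \x mu)%E.-integrable [set: T] H'.
  apply/integrable21ltyP => //.
  have := (integrable21ltyP _ _ mH).1 iH; apply: le_lt_trans.
  rewrite le_eqVlt; apply/orP; left; apply/eqP; apply: eq_integral => s _.
  rewrite -(Hshift s (fun y => `|y|)%E).
  apply: (@ge0_integral_shift _ s (fun x => `|H (x, s)|%E)) => //.
  apply: measurableT_comp => //; exact: mH1.
have LE x : (f x * co_average k psi x)%:E = (\int[mu]_s H (x, s))%E.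
  rewrite /co_average.
  rewrite -RintegralZl //; last exact: co_average_integrable kh ps.
  rewrite EFin_Rintegral //.
  have := integrableZl measurableT (f x) (co_average_integrable x kh ps).
  by apply: eq_integrable => // s _; rewrite /= EFinM.
have RE x : (average k f x * psi x)%:E = (\int[mu]_s H' (x, s))%E.
  rewrite /average.
  rewrite -RintegralZr //; last exact: average_integrable kh fs.
  rewrite EFin_Rintegral //.
  have := integrableZr measurableT (psi x) (average_integrable x kh fs).
  by apply: eq_integrable => // s _; rewrite /= EFinM.
rewrite /Rintegral; congr fine.
under eq_integral do rewrite LE.
under [RHS]eq_integral do rewrite RE.
rewrite (Fubini iH) (Fubini iH').
apply: eq_integral => s _.
rewrite -(Hshift s id); apply/esym.
exact: (@integral_shift _ s (fun x => H (x, s))).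
Qed.

End averaging.

(** * Lebesgue norms of real functions *)

Section Lp_norm.
Context {R : realType}.
Local Notation mu := (@lebesgue_measure R).
Implicit Types (f g : R -> R) (p : \bar R).
Local Open Scope ereal_scope.

Local Notation "'N_ p [ f ]" := (Lnorm mu p (EFin \o f)).

Lemma lebesgue_measureT_gt0 : 0 < mu [set: R].
Proof.
apply: (@lt_le_trans _ _ (mu `[0%R, 1%R]%classic)).
  by rewrite lebesgue_measure_itv /= lte01 -EFinB subr0 lte01.
apply: le_measure => //; apply/mem_set; last exact: measurableT.
exact: (@measurable_itv R `[0%R, 1%R]).
Qed.

Lemma LnormyE f : 'N_+oo[f] = ess_sup mu (fun x => `|f x|%:E).
Proof. by rewrite unlock lebesgue_measureT_gt0. Qed.

Lemma LnormrE (r : R) f :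
  'N_r%:E[f] = (\int[mu]_x (`|f x| `^ r)%:E) `^ r^-1.
Proof. by rewrite unlock. Qed.

Lemma measurable_normr_powR (r : R) f : measurable_fun [set: R] f ->
  measurable_fun [set: R] (fun x => (`|f x| `^ r)%R).
Proof.
move=> mf; apply: (measurableT_comp (measurable_powR r)).
exact: measurableT_comp.
Qed.

Lemma poweR_le (r : R) (x y : \bar R) : (0 <= r)%R -> 0 <= x -> x <= y ->
  x `^ r <= y `^ r.
Proof.
move=> r0 x0 xy; apply: gt0_ler_poweR => //; rewrite in_itv /= leey andbT //.
exact: le_trans xy.
Qed.

(** Monotonicity and homogeneity of the norm in one statement, the form in which
    pointwise bounds are used below. *)
Lemma Lnorm_le_scale p (c : R) f g : 1 <= p -> (0 <= c)%R ->
  measurable_fun [set: R] f -> measurable_fun [set: R] g ->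
  (forall x, `|f x| <= c * `|g x|)%R -> 'N_p[f] <= c%:E * 'N_p[g].
Proof.
case: p => [r|_|//].
  rewrite lee_fin => r1 c0 mf mg fg.
  have r0 : (0 < r)%R by rewrite (lt_le_trans _ r1).
  rewrite !LnormrE.
  have cE : c%:E = (c%:E `^ r) `^ r^-1.
    by rewrite -poweRrM divff ?gt_eqF// poweRe1.
  rewrite [in leRHS]cE -poweRM ?poweR_ge0//; last first.
    by apply: integral_ge0 => x _; rewrite lee_fin powR_ge0.
  apply: poweR_le; first by rewrite invr_ge0 ltW.
    by apply: integral_ge0 => x _; rewrite lee_fin powR_ge0.
  rewrite -ge0_integralZl//=; first last.
  - by rewrite lee_fin powR_ge0.
  - by apply/measurable_EFinP; exact: measurable_normr_powR.
  apply: ge0_le_integral => //.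
  - by apply/measurable_EFinP; exact: measurable_normr_powR.
  - apply/measurable_EFinP; apply: measurable_funM => //.
    exact: measurable_normr_powR.
  - move=> x _; rewrite lee_fin -powRM//.
    by apply: ge0_ler_powR; rewrite ?nnegrE ?mulr_ge0// ltW.
move=> c0 mf mg fg; rewrite !LnormyE.
rewrite -ess_supZl ?lebesgue_measureT_gt0//.
by apply: le_ess_sup; apply: nearW => x /=; rewrite lee_fin.
Qed.

Lemma ae_shift (a : R) (P : R -> Prop) : {ae mu, forall x, P x} ->
  {ae mu, forall x, P (x + a)%R}.
Proof.
move=> [N [mN N0 PN]]; exists ((fun x : R => (x + a)%R) @^-1` N); split.
- rewrite -(setTI (_ @^-1` _)).
  exact: (@measurable_shift _ a measurableT _ mN).
- by rewrite lebesgue_measure_shift.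
- by move=> x /= Px; apply: PN.
Qed.

Lemma Lnorm_shift p (a : R) f : 1 <= p -> measurable_fun [set: R] f ->
  'N_p[(fun x => f (x + a)%R)] <= 'N_p[f].
Proof.
case: p => [r|_|//].
  move=> _ mf; rewrite !LnormrE.
  rewrite (@ge0_integral_shift _ a (fun x => (`|f x| `^ r)%:E)) //.
  by apply/measurable_EFinP; exact: measurable_normr_powR.
move=> mf; rewrite !LnormyE; apply/ess_supP.
apply: (@ae_shift a (fun x => `|f x|%:E <= _)).
exact: ess_sup_ge.
Qed.

(** Extended real valued, so that Tonelli's theorem applies to every nonnegative
    measurable [g]. *)
Definition window (h : R) g : R -> \bar R :=
  fun x => \int[mu]_s (\1_(`[0%R, h] : set R) s * g (x + s)%R)%:E.

Lemma lebesgue_measure_itvcc (a b : R) : (a <= b)%R ->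
  mu `[a, b]%classic = (b - a)%:E.
Proof.
move=> ab; rewrite lebesgue_measure_itv /= lte_fin.
case: ltP => [_|ba]; first by rewrite EFinB.
have -> : a = b by apply/le_anti; rewrite ab ba.
by rewrite subrr.
Qed.

Lemma measurable_window_arg (h : R) g : measurable_fun [set: R] g ->
  measurable_fun [set: measurableTypeR R * measurableTypeR R]
   (fun z : measurableTypeR R * measurableTypeR R =>
      (\1_(`[0%R, h] : set R) z.2 * g (z.1 + z.2)%R)%:E).
Proof.
move=> mg; apply/measurable_EFinP; apply: measurable_funM.
  by apply: measurableT_comp; [exact: measurable_indic|exact: measurable_snd].
apply: measurableT_comp => //; apply: measurable_funD.
  exact: measurable_fst.
exact: measurable_snd.
Qed.

Lemma measurable_window (h : R) g : measurable_fun [set: R] g ->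
  (forall x, 0 <= g x)%R -> measurable_fun [set: R] (window h g).
Proof.
move=> mg g0.
apply: (measurable_fun_fubini_tonelli_F _ (measurable_window_arg h mg)) => z.
by rewrite lee_fin mulr_ge0 ?g0.
Qed.

Lemma integral_window (h : R) g : (0 <= h)%R -> measurable_fun [set: R] g ->
  (forall x, 0 <= g x)%R ->
  \int[mu]_x window h g x = h%:E * \int[mu]_x (g x)%:E.
Proof.
move=> h0 mg g0.
have := fubini_tonelli (m1 := mu) (m2 := mu) _ (measurable_window_arg h mg).
move=> /= -> => [|z]; last by rewrite lee_fin mulr_ge0 ?g0.
rewrite -[X in _ = X%:E * _]subr0 -lebesgue_measure_itvcc//.
have -> : mu `[0%R, h]%classic = \int[mu]_s (\1_(`[0%R, h] : set R) s)%:E.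
  by rewrite integral_indic// setIT.
rewrite -ge0_integralZr//.
- apply: eq_integral => s _; under eq_integral do rewrite EFinM.
  rewrite ge0_integralZl//.
  + congr (_ * _); apply: (@ge0_integral_shift _ s (EFin \o g)) => //.
    exact/measurable_EFinP.
  + by apply/measurable_EFinP; exact: measurable_fun_shift.
  + by move=> x _; rewrite lee_fin.
- by apply/measurable_EFinP; exact: measurable_indic.
- by apply: integral_ge0 => x _; rewrite lee_fin.
Qed.

(** Jensen's inequality for the uniform measure on an interval of length [h],
    obtained from Hoelder's inequality by pairing with the indicator function. *)
Lemma window_powR (r h : R) g x : (1 <= r)%R -> (0 <= h)%R ->
  measurable_fun [set: R] g -> (forall x, 0 <= g x)%R ->
  window h g x `^ r <= (h `^ (r - 1))%:E * window h (fun y => g y `^ r)%R x.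
Proof.
move=> r1 h0 mg g0.
have w0 f : (forall x, 0 <= f x)%R -> 0 <= window h f x.
  by move=> f0; apply: integral_ge0 => s _; rewrite lee_fin mulr_ge0.
move: r1; rewrite le_eqVlt => /predU1P[<-|r1].
  rewrite poweRe1 ?w0// subrr powRr0 mul1e.
  under [X in _ <= window h X _]eq_fun do rewrite powRr1//.
  exact: lexx.
have r0 : (0 < r)%R by rewrite (lt_trans _ r1).
pose q := (r / (r - 1))%R.
have q0 : (0 < q)%R by rewrite /q divr_gt0 ?subr_gt0.
have rq : (r^-1 + q^-1 = 1)%R.
  by rewrite /q; field; rewrite !gt_eqF ?subr_gt0.
pose I : R -> R := \1_(`[0%R, h] : set R).
pose f s := (I s * g (x + s))%R.
have mI : measurable_fun [set: R] I by exact: measurable_indic.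
have mf : measurable_fun [set: R] f.
  apply: measurable_funM => //.
  by apply: measurableT_comp => //; exact: measurable_addr.
have II s : (I s * I s = I s)%R.
  by rewrite /I indicE -natrM; case: (_ \in _).
have f0 s : (0 <= f s)%R by rewrite /f /I mulr_ge0.
have := hoelder mu mf mI r0 q0 rq; rewrite Lnorm1.
have -> : \int[mu]_s `|(EFin \o (f \* I)%R) s| = window h g x.
  apply: eq_integral => s _; rewrite /= ger0_norm ?mulr_ge0//.
  by rewrite /f mulrAC II.
move=> /(poweR_le (ltW r0) (w0 _ g0)) /le_trans; apply.
have rn0 : r != 0%R by rewrite gt_eqF.
rewrite poweRM ?Lnorm_ge0// (poweR_Lnorm mu (EFin \o f) rn0) muleC.
apply: lee_pmul; rewrite ?poweR_ge0//.
- by apply: integral_ge0 => s _; rewrite poweR_ge0.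
- have -> : 'N_q%:E[I] = h%:E `^ q^-1.
    rewrite LnormrE; congr (_ `^ _).
    rewrite -[in RHS](subr0 h) -lebesgue_measure_itvcc//.
    rewrite -(setIT `[0%R, h]%classic) -integral_indic//.
    apply: eq_integral => s _; rewrite /I indicE.
    by case: (_ \in _); rewrite ?normr1 ?normr0 ?powR1 ?powR0// gt_eqF.
  rewrite -poweRrM poweR_EFin lee_fin le_eqVlt; apply/orP; left; apply/eqP.
  by congr (h `^ _)%R; rewrite /q; field; rewrite !gt_eqF ?subr_gt0.
- rewrite le_eqVlt; apply/orP; left; apply/eqP; apply: eq_integral => s _.
  rewrite /= ger0_norm// /f /I indicE; case: (_ \in _).
    by rewrite !mul1r.
  by rewrite !mul0r powR0// gt_eqF.
Qed.

(** Young's convolution inequality for a kernel bounded by 1 on an interval of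
    length [h].  For finite exponents it is Jensen's inequality followed by
    Tonelli's theorem, for the infinite exponent the bound is pointwise. *)
Lemma Lnorm_window_le p (h : R) f g : 1 <= p -> (0 < h)%R ->
  measurable_fun [set: R] f -> measurable_fun [set: R] g ->
  (forall x, 0 <= g x)%R -> (forall x, `|f x|%:E <= window h g x) ->
  'N_p[f] <= h%:E * 'N_p[g].
Proof.
case: p => [r|_|//].
  rewrite lee_fin => r1 h0 mf mg g0 fg.
  have r0 : (0 < r)%R by rewrite (lt_le_trans _ r1).
  have w0 k x : (forall x, 0 <= k x)%R -> 0 <= window h k x.
    by move=> k0; apply: integral_ge0 => s _; rewrite lee_fin mulr_ge0.
  have mgr : measurable_fun [set: R] (fun y => g y `^ r)%R.
    exact: (measurableT_comp (measurable_powR r)).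
  have gr0 y : (0 <= g y `^ r)%R by exact: powR_ge0.
  rewrite !LnormrE.
  have hE : h%:E = (h%:E `^ r) `^ r^-1.
    by rewrite -poweRrM divff ?gt_eqF// poweRe1// lee_fin ltW.
  have i0 k : 0 <= \int[mu]_x (`|k x| `^ r)%:E.
    by apply: integral_ge0 => x _; rewrite lee_fin powR_ge0.
  rewrite [in leRHS]hE -poweRM ?poweR_ge0//.
  apply: poweR_le => //; first by rewrite invr_ge0 ltW.
  have -> : \int[mu]_x (`|g x| `^ r)%:E = \int[mu]_x (g x `^ r)%:E.
    by apply: eq_integral => x _; rewrite ger0_norm.
  have -> : h%:E `^ r = (h `^ (r - 1))%:E * h%:E.
    by rewrite -EFinM poweR_EFin mulrC mulr_powRB1 // ltW.
  rewrite -muleA -integral_window ?(ltW h0)//.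
  rewrite -ge0_integralZl//; first last.
  - by rewrite lee_fin powR_ge0.
  - by move=> x _; exact: w0.
  - exact: measurable_window.
  apply: ge0_le_integral => //.
  - by apply/measurable_EFinP; exact: measurable_normr_powR.
  - apply: emeasurable_funM => //; exact: measurable_window.
  - move=> x _; apply: le_trans (window_powR _ r1 (ltW h0) mg g0).
    by rewrite -poweR_EFin; apply: poweR_le => //; exact: ltW.
move=> h0 mf mg g0 fg; rewrite !LnormyE.
set M := ess_sup mu (fun x => `|g x|%:E).
have M0 : 0 <= M.
  by apply: ess_sup_gee; [exact: lebesgue_measureT_gt0|apply: nearW].
have [->|My] := eqVneq M +oo; first by rewrite gt0_muley ?lte_fin// leey.
have Mf : M \is a fin_num by rewrite ge0_fin_numE// lt_neqAle My leey.
have gM : {ae mu, forall x, `|g x|%:E <= M} by exact: ess_sup_ge.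
apply/ess_supP; apply: nearW => x; apply: le_trans (fg x) _.
have -> : h%:E * M = \int[mu]_s ((\1_(`[0%R, h] : set R) s)%:E * M).
  rewrite ge0_integralZr//; last exact/measurable_EFinP.
  rewrite integral_indic// setIT; congr (_ * _).
  by rewrite -[in LHS](subr0 h) -lebesgue_measure_itvcc// ltW.
apply: ae_ge0_le_integral => //.
- by move=> s _; rewrite lee_fin mulr_ge0.
- apply/measurable_EFinP; apply: measurable_funM => //.
  by apply: measurableT_comp => //; exact: measurable_addr.
- by move=> s _; rewrite mule_ge0// lee_fin.
- apply: emeasurable_funM => //; exact/measurable_EFinP.
- have [N [mN N0 sub]] := @ae_shift x _ gM.
  exists N; split => // s /= ns; apply: sub => /= gs; apply: ns => _.
  rewrite EFinM; apply: lee_pmul => //; rewrite ?lee_fin//.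
  by apply: le_trans gs; rewrite lee_fin addrC ler_norm.
Qed.

End Lp_norm.

(** * Lebesgue norms of complex functions *)

Section complex_Lp.
Context {R : realType}.
Local Notation mu := (@lebesgue_measure R).
Local Open Scope complex_scope.
Implicit Types (f g a : R -> R[i]) (p : \bar R) (z : R[i]).

Lemma modulusE z : modulus z = Num.sqrt (complex.Re z ^+ 2 + complex.Im z ^+ 2).
Proof. by case: z. Qed.

Lemma modulus_ge0 z : 0 <= modulus z.
Proof. by rewrite modulusE sqrtr_ge0. Qed.
Hint Resolve modulus_ge0 : core.

Lemma modulusD z z' : modulus (z + z') <= modulus z + modulus z'.
Proof. exact: le_normcD. Qed.

Lemma modulusM z z' : modulus (z * z') = modulus z * modulus z'.
Proof. exact: ComplexField.Normc.normcM. Qed.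

Lemma modulusN z : modulus (- z) = modulus z.
Proof. exact: normcN. Qed.

Lemma modulus_real (c : R) : modulus c%:C = `|c|.
Proof. by rewrite modulusE /= expr0n addr0 sqrtr_sqr. Qed.

Lemma modulus_nat (n : nat) : modulus (n%:R : R[i]) = n%:R.
Proof.
have -> : n%:R = (n%:R : R)%:C :> R[i] by rewrite rmorph_nat.
by rewrite modulus_real ger0_norm.
Qed.

Lemma sqr_modulus z : modulus z ^+ 2 = complex.Re z ^+ 2 + complex.Im z ^+ 2.
Proof. by rewrite modulusE sqr_sqrtr// addr_ge0 ?sqr_ge0. Qed.

Lemma normr_Re_le z : `|complex.Re z| <= modulus z.
Proof. by rewrite modulusE -sqrtr_sqr ler_wsqrtr// lerDl sqr_ge0. Qed.

Lemma normr_Im_le z : `|complex.Im z| <= modulus z.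
Proof. by rewrite modulusE -sqrtr_sqr ler_wsqrtr// lerDr sqr_ge0. Qed.

Lemma cmeasurable_modulus f : cmeasurable f ->
  measurable_fun [set: R] (fun x => modulus (f x)).
Proof.
move=> [mr mi].
have -> : (fun x => modulus (f x)) =
    (fun x => (ReF f x ^+ 2 + ImF f x ^+ 2) `^ 2^-1).
  apply/funext => x; rewrite modulusE powR12_sqrt //.
  by rewrite addr_ge0 ?sqr_ge0.
apply: (measurableT_comp (measurable_powR 2^-1)).
by apply: measurable_funD; exact: measurable_funX.
Qed.

Lemma cmeasurableD f g : cmeasurable f -> cmeasurable g ->
  cmeasurable (fun x => f x + g x).
Proof.
move=> [fr fi] [gr gi]; split.
- have -> : ReF (fun x => f x + g x) = ReF f \+ ReF g.
    by apply/funext => x; rewrite /ReF /=; case: (f x); case: (g x).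
  exact: measurable_funD.
- have -> : ImF (fun x => f x + g x) = ImF f \+ ImF g.
    by apply/funext => x; rewrite /ImF /=; case: (f x); case: (g x).
  exact: measurable_funD.
Qed.

Lemma cmeasurableM f g : cmeasurable f -> cmeasurable g ->
  cmeasurable (fun x => f x * g x).
Proof.
move=> [fr fi] [gr gi]; split.
- have -> : ReF (fun x => f x * g x) = (ReF f \* ReF g) \- (ImF f \* ImF g).
    by apply/funext => x; rewrite /ReF /ImF /=; case: (f x); case: (g x).
  by apply: measurable_funB; exact: measurable_funM.
- have -> : ImF (fun x => f x * g x) = (ReF f \* ImF g) \+ (ImF f \* ReF g).
    by apply/funext => x; rewrite /ReF /ImF /=; case: (f x); case: (g x).
  by apply: measurable_funD; exact: measurable_funM.
Qed.

Lemma cmeasurable_cst z : cmeasurable (fun=> z).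
Proof. by split; exact: measurable_cst. Qed.

Lemma cmeasurable_shift (b : R) f : cmeasurable f ->
  cmeasurable (fun x => f (x + b)).
Proof.
move=> [fr fi]; split.
- exact: (measurable_fun_shift b fr).
- exact: (measurable_fun_shift b fi).
Qed.

Lemma derivable_continuous (g : R -> R) :
  (forall x : R, derivable g x 1) -> continuous g.
Proof.
by move=> dg x; move/derivable1_diffP/differentiable_continuous : (dg x).
Qed.

Lemma smooth_cmeasurable f : smooth f -> cmeasurable f.
Proof.
move=> sf; split; apply: continuous_measurable_fun;
  by apply: derivable_continuous => x; have [] := sf 0%N x.
Qed.

Lemma Lpnorm_le_scale p (c : R) f g : (1 <= p)%E -> 0 <= c ->
  cmeasurable f -> cmeasurable g ->
  (forall x, modulus (f x) <= c * modulus (g x)) ->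
  (Lpnorm p f <= c%:E * Lpnorm p g)%E.
Proof.
move=> p1 c0 /cmeasurable_modulus mf /cmeasurable_modulus mg fg.
apply: (Lnorm_le_scale p1 c0 mf mg) => x.
by rewrite !ger0_norm.
Qed.

Lemma Lpnorm_ge0 p f : (0 <= Lpnorm p f)%E.
Proof. exact: Lnorm_ge0. Qed.

Lemma Lpnorm_add p f g : (1 <= p)%E -> cmeasurable f -> cmeasurable g ->
  (Lpnorm p (fun x => f x + g x)%R <= Lpnorm p f + Lpnorm p g)%E.
Proof.
move=> p1 mf mg.
have mf' := cmeasurable_modulus mf; have mg' := cmeasurable_modulus mg.
apply: le_trans (eminkowski mu mf' mg' p1).
rewrite -[leRHS]mul1e; apply: (@Lnorm_le_scale _ p 1) => //.
- by apply: cmeasurable_modulus; exact: cmeasurableD.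
- exact: measurable_funD.
- by move=> x; rewrite mul1r /= !ger0_norm ?addr_ge0// modulusD.
Qed.

Lemma Lpnorm_shift p (b : R) f : (1 <= p)%E -> cmeasurable f ->
  (Lpnorm p (fun x => f (x + b))%R <= Lpnorm p f)%E.
Proof.
by move=> p1 /cmeasurable_modulus mf; exact: (Lnorm_shift b p1 mf).
Qed.

(** For a finite exponent r, |f| <= 1 + |f| ^ r; for the infinite one, [f] is
    almost everywhere bounded. *)
Lemma Lnorm_locally_summable p (f : R -> R) : (1 <= p)%E ->
  measurable_fun [set: R] f -> (Lnorm mu p (EFin \o f) < +oo)%E ->
  locally_summable f.
Proof.
move=> p1 mf fp; split => // N.
have m1 : measurable_fun [set: R] (\1_(`[- N, N] : set R) : R -> R).
  exact: measurable_indic.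
case: p p1 fp => [r|_|//].
  rewrite lee_fin => r1; rewrite LnormrE => /lty_poweRy fr.
  have r0 : 0 < r by rewrite (lt_le_trans _ r1).
  have {}fr : mu.-integrable [set: R] (EFin \o (fun x => `|f x| `^ r)).
    apply/integrableP; split.
      by apply/measurable_EFinP; exact: measurable_normr_powR.
    under eq_integral do rewrite /= ger0_norm ?powR_ge0//.
    by apply: fr; rewrite invr_eq0 gt_eqF.
  have gi := integrableD measurableT fr (integrable_indic_itv (- N) N).
  apply: (@integrable_bound _ _ (fun x => `|f x| `^ r + \1_(`[- N, N] : set R) x)).
  - exact: measurable_funM.
  - move=> x; rewrite normrM [leRHS]ger0_norm ?addr_ge0 ?powR_ge0//.
    rewrite indicE; case: (_ \in _); rewrite ?normr0 ?normr1 ?mulr0 ?mulr1;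
      last by rewrite addr0 powR_ge0.
    have [f1|f1] := leP `|f x| 1; first by rewrite ler_wpDl ?powR_ge0.
    rewrite ler_wpDr// -[leLHS]powRr1//; apply: ler_powR => //; exact: ltW.
  - by move: gi; apply: eq_integrable.
rewrite LnormyE; set M := ess_sup _ _ => My.
have gM : {ae mu, forall x, (`|f x|%:E <= M)%E} by exact: ess_sup_ge.
have M0 : (0 <= M)%E.
  by apply: ess_sup_gee; [exact: lebesgue_measureT_gt0|apply: nearW].
have Mf : M \is a fin_num by rewrite ge0_fin_numE.
apply/integrableP; split; first by apply/measurable_EFinP; exact: measurable_funM.
have := integrable_lty measurableT
  (integrableZl measurableT (fine M) (integrable_indic_itv (- N) N)).
apply: le_lt_trans; apply: ae_ge0_le_integral => //.
- by apply: measurableT_comp => //; apply/measurable_EFinP; exact: measurable_funM.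
- by move=> s _; apply: mule_ge0; rewrite lee_fin ?fine_ge0.
- exact: measurable_int (integrableZl measurableT (fine M)
    (integrable_indic_itv (- N) N)).
- have [Z [mZ Z0 sub]] := gM.
  exists Z; split => // s /= ns; apply: sub => /= gs; apply: ns => _.
  rewrite normrM EFinM -/(abse _) fineK//; apply: lee_pmul => //.
  by rewrite lee_fin ger0_norm.
Qed.

End complex_Lp.

(** * Pairing functions with test functions *)

Section pairing.
Context {R : realType}.
Local Notation mu := (@lebesgue_measure R).
Local Open Scope complex_scope.
Implicit Types (f g a phi psi : R -> R[i]) (p : \bar R) (z : R[i]).

Lemma inLp_locally_summable p f : (1 <= p)%E -> inLp p f ->
  [/\ locally_summable (ReF f), locally_summable (ImF f) &
      locally_summable (fun x => modulus (f x))].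
Proof.
move=> p1 [[mr mi] fp].
have mm : measurable_fun [set: R] (fun x => modulus (f x)).
  exact: cmeasurable_modulus.
split.
- apply: (Lnorm_locally_summable p1) => //; apply: le_lt_trans fp.
  rewrite -[leRHS]mul1e; apply: (Lnorm_le_scale p1) => // x.
  by rewrite mul1r [leRHS]ger0_norm ?modulus_ge0 ?normr_Re_le.
- apply: (Lnorm_locally_summable p1) => //; apply: le_lt_trans fp.
  rewrite -[leRHS]mul1e; apply: (Lnorm_le_scale p1) => // x.
  by rewrite mul1r [leRHS]ger0_norm ?modulus_ge0 ?normr_Im_le.
- exact: (Lnorm_locally_summable p1).
Qed.

Definition caverage (k : R -> R) f : R -> R[i] :=
  fun x => average k (ReF f) x +i* average k (ImF f) x.

Definition cco_average (k : R -> R) f : R -> R[i] :=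
  fun x => co_average k (ReF f) x +i* co_average k (ImF f) x.

Lemma kernel_on_indic (h : R) : kernel_on h (\1_(`[0, h] : set R) : R -> R).
Proof.
split; first exact: measurable_indic.
by move=> s; rewrite ger0_norm.
Qed.

(** The triangle inequality for an integral defined by components.  If X + iY is
    the average and m its modulus, then m^2 is the integral of
    k (X Re f + Y Im f), which is at most m |k| |f| by the Cauchy-Schwarz
    inequality in the plane; dividing by m gives the claim. *)
Lemma modulus_caverage_le p (h : R) (k : R -> R) f x : (1 <= p)%E ->
  kernel_on h k -> inLp p f ->
  ((modulus (caverage k f x))%:E <= window h (fun y => modulus (f y)) x)%E.
Proof.
move=> p1 kh fp; have [fr fi fm] := inLp_locally_summable p1 fp.
have ir := average_integrable x kh fr.
have ii := average_integrable x kh fi.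
have im := average_integrable x (kernel_on_indic h) fm.
rewrite /window -EFin_Rintegral // lee_fin.
set W := \int[mu]_s _.
have W0 : 0 <= W by apply: Rintegral_ge0 => s _; rewrite mulr_ge0 ?modulus_ge0.
set X := average k (ReF f) x; set Y := average k (ImF f) x.
have cE : caverage k f x = X +i* Y by [].
rewrite cE; set m := modulus _.
have m0 : 0 <= m by exact: modulus_ge0.
have mm : m ^+ 2 = X ^+ 2 + Y ^+ 2 by exact: sqr_modulus.
have lin : X ^+ 2 + Y ^+ 2 =
    \int[mu]_s (X * (k s * ReF f (x + s)) + Y * (k s * ImF f (x + s))).
  rewrite RintegralD//; last 2 first.
  - by have := integrableZl measurableT X ir; apply: eq_integrable.
  - by have := integrableZl measurableT Y ii; apply: eq_integrable.
  by rewrite RintegralZl// RintegralZl.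
have le : X ^+ 2 + Y ^+ 2 <= m * W.
  rewrite lin /W -RintegralZl//.
  apply: le_Rintegral => //.
  - have := integrableD measurableT (integrableZl measurableT X ir)
      (integrableZl measurableT Y ii).
    by apply: eq_integrable.
  - by have := integrableZl measurableT m im; apply: eq_integrable.
  - move=> s _.
    have cs : X * ReF f (x + s) + Y * ImF f (x + s) <= m * modulus (f (x + s))
      /\ - (X * ReF f (x + s) + Y * ImF f (x + s)) <= m * modulus (f (x + s)).
      have : `|X * ReF f (x + s) + Y * ImF f (x + s)| <= m * modulus (f (x + s)).
        rewrite -(@ler_pXn2r _ 2%N) ?nnegrE ?mulr_ge0 ?modulus_ge0//.
        rewrite exprMn mm sqr_modulus real_normK ?num_real// /ReF /ImF.
        by have := sqr_ge0 (X * complex.Im (f (x + s)) - Y * complex.Re (f (x + s))); nra.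
      by rewrite ler_norml => /andP[h1 h2]; split => //; lra.
    have ks : `|k s| <= \1_(`[0, h] : set R) s by exact: kh.2.
    have M0 : 0 <= m * modulus (f (x + s)) by rewrite mulr_ge0 ?modulus_ge0.
    have -> : X * (k s * ReF f (x + s)) + Y * (k s * ImF f (x + s)) =
      k s * (X * ReF f (x + s) + Y * ImF f (x + s)) by ring.
    rewrite [leRHS]mulrCA; apply: le_trans (ler_norm _) _; rewrite normrM.
    apply: ler_pM => //; rewrite ler_norml; apply/andP; split; lra.
have [->//|mn0] := eqVneq m 0.
have mp : 0 < m by rewrite lt_neqAle eq_sym mn0.
by rewrite -(ler_pM2l mp) -expr2 mm.
Qed.

Lemma caverage_inLp p (h : R) (k : R -> R) f : (1 <= p)%E -> 0 < h ->
  kernel_on h k -> inLp p f ->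
  inLp p (caverage k f) /\ (Lpnorm p (caverage k f) <= h%:E * Lpnorm p f)%E.
Proof.
move=> p1 h0 kh fp; have [mf fy] := fp.
have mc : cmeasurable (caverage k f).
  by split; [exact: (measurable_average kh.1 mf.1)|exact: (measurable_average kh.1 mf.2)].
have le : (Lpnorm p (caverage k f) <= h%:E * Lpnorm p f)%E.
  apply: (Lnorm_window_le p1 h0) => //.
  - exact: cmeasurable_modulus.
  - exact: cmeasurable_modulus.
  - by move=> x; exact: modulus_ge0.
  - move=> x; rewrite ger0_norm ?modulus_ge0//.
    exact: (modulus_caverage_le _ p1 kh fp).
split => //; split => //; apply: le_lt_trans le _.
by rewrite lte_mul_pinfty// lee_fin ltW.
Qed.

Definition cintegrable (F : R -> R[i]) :=
  mu.-integrable [set: R] (EFin \o ReF F) /\ mu.-integrable [set: R] (EFin \o ImF F).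

Lemma ReFD f g x : ReF (fun y => f y + g y) x = ReF f x + ReF g x.
Proof. by rewrite /ReF /=; case: (f x); case: (g x). Qed.

Lemma ImFD f g x : ImF (fun y => f y + g y) x = ImF f x + ImF g x.
Proof. by rewrite /ImF /=; case: (f x); case: (g x). Qed.

Lemma ReFM f g x :
  ReF (fun y => f y * g y) x = ReF f x * ReF g x - ImF f x * ImF g x.
Proof. by rewrite /ReF /ImF /=; case: (f x); case: (g x). Qed.

Lemma ImFM f g x :
  ImF (fun y => f y * g y) x = ReF f x * ImF g x + ImF f x * ReF g x.
Proof. by rewrite /ReF /ImF /=; case: (f x); case: (g x). Qed.

Lemma cintegralD F G : cintegrable F -> cintegrable G ->
  cintegral (fun x => F x + G x) = cintegral F + cintegral G.
Proof.
move=> [Fr Fi] [Gr Gi]; rewrite /cintegral.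
have -> : ReF (fun x => F x + G x) = (fun x => ReF F x + ReF G x).
  by apply/funext => x; rewrite ReFD.
have -> : ImF (fun x => F x + G x) = (fun x => ImF F x + ImF G x).
  by apply/funext => x; rewrite ImFD.
by rewrite !RintegralD.
Qed.

Lemma cintegralZ z F : cintegrable F ->
  cintegral (fun x => z * F x) = z * cintegral F.
Proof.
move=> [Fr Fi]; rewrite /cintegral.
have -> : ReF (fun x => z * F x) =
    (fun x => complex.Re z * ReF F x - complex.Im z * ImF F x).
  by apply/funext => x; rewrite (ReFM (fun=> z)).
have -> : ImF (fun x => z * F x) =
    (fun x => complex.Re z * ImF F x + complex.Im z * ReF F x).
  by apply/funext => x; rewrite (ImFM (fun=> z)).
rewrite RintegralB ?RintegralD ?RintegralZl//; last 4 first.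
- by have := integrableZl measurableT (complex.Re z) Fi; apply: eq_integrable.
- by have := integrableZl measurableT (complex.Im z) Fr; apply: eq_integrable.
- by have := integrableZl measurableT (complex.Re z) Fr; apply: eq_integrable.
- by have := integrableZl measurableT (complex.Im z) Fi; apply: eq_integrable.
by case: z => a b.
Qed.

(** What the pairing with locally integrable functions asks of a test function. *)
Definition cbounded_support phi := exists N C, 
  bounded_support N C (ReF phi) /\ bounded_support N C (ImF phi).

Lemma cintegrable_pairing p f phi : (1 <= p)%E -> inLp p f ->
  cbounded_support phi -> cintegrable (fun x => f x * phi x).
Proof.
move=> p1 fp [N [C [br bi]]]; have [fr fi _] := inLp_locally_summable p1 fp.
split.
- have := integrableB measurableT (integrableM_bounded_support fr br)
    (integrableM_bounded_support fi bi).
  by apply: eq_integrable => // x _; rewrite /= ReFM EFinB.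
- have := integrableD measurableT (integrableM_bounded_support fr bi)
    (integrableM_bounded_support fi br).
  by apply: eq_integrable => // x _; rewrite /= ImFM EFinD.
Qed.

Lemma dist_ofDl p f g phi : (1 <= p)%E -> inLp p f -> inLp p g ->
  cbounded_support phi ->
  dist_of (fun x => f x + g x) phi = dist_of f phi + dist_of g phi.
Proof.
move=> p1 fp gp bp; rewrite /dist_of -cintegralD; first last.
- exact: (cintegrable_pairing p1 gp bp).
- exact: (cintegrable_pairing p1 fp bp).
by congr cintegral; apply/funext => x; rewrite mulrDl.
Qed.

Lemma dist_ofDr p f phi psi : (1 <= p)%E -> inLp p f ->
  cbounded_support phi -> cbounded_support psi ->
  dist_of f (fun x => phi x + psi x) = dist_of f phi + dist_of f psi.
Proof.
move=> p1 fp b1 b2; rewrite /dist_of -cintegralD; first last.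
- exact: (cintegrable_pairing p1 fp b2).
- exact: (cintegrable_pairing p1 fp b1).
by congr cintegral; apply/funext => x; rewrite mulrDr.
Qed.

Lemma dist_ofZl p z f phi : (1 <= p)%E -> inLp p f -> cbounded_support phi ->
  dist_of (fun x => z * f x) phi = z * dist_of f phi.
Proof.
move=> p1 fp bp; rewrite /dist_of -cintegralZ; last first.
  exact: (cintegrable_pairing p1 fp bp).
by congr cintegral; apply/funext => x; rewrite mulrA.
Qed.

Lemma dist_ofZr p z f phi : (1 <= p)%E -> inLp p f -> cbounded_support phi ->
  dist_of f (fun x => z * phi x) = z * dist_of f phi.
Proof.
move=> p1 fp bp; rewrite -(dist_ofZl z p1 fp bp) /dist_of.
by congr cintegral; apply/funext => x; rewrite mulrCA mulrA.
Qed.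

Lemma dist_of_shift (b : R) f psi : cmeasurable f -> cmeasurable psi ->
  dist_of f (fun x => psi (x - b)) = dist_of (fun x => f (x + b)) psi.
Proof.
move=> mf mp.
have [mr mi] : cmeasurable (fun x => f x * psi (x - b)).
  by apply: cmeasurableM => //; exact: cmeasurable_shift.
rewrite /dist_of /cintegral -(Rintegral_shift b mr) -(Rintegral_shift b mi).
by congr (_ +i* _); congr Rintegral; apply/funext => x; rewrite /ReF /ImF addrK.
Qed.

Lemma dist_of_cco_average p (h : R) (k : R -> R) f psi : (1 <= p)%E -> 0 < h ->
  kernel_on h k -> inLp p f -> cbounded_support psi ->
  cbounded_support (cco_average k psi) ->
  dist_of f (cco_average k psi) = dist_of (caverage k f) psi.
Proof.
move=> p1 h0 kh fp [N [C [br bi]]] [N' [C' [br' bi']]].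
have [fr fi _] := inLp_locally_summable p1 fp.
have [cp _] := caverage_inLp p1 h0 kh fp.
have [cr ci _] := inLp_locally_summable p1 cp.
rewrite /dist_of /cintegral; congr (_ +i* _).
- have -> : ReF (fun x => f x * cco_average k psi x) =
      (fun x => ReF f x * co_average k (ReF psi) x
         - ImF f x * co_average k (ImF psi) x).
    by apply/funext => x; rewrite ReFM.
  rewrite RintegralB//; last 2 first.
  - exact: (integrableM_bounded_support fr br').
  - exact: (integrableM_bounded_support fi bi').
  rewrite (average_duality kh fr br) (average_duality kh fi bi).
  rewrite -RintegralB//; last 2 first.
  - exact: (integrableM_bounded_support cr br).
  - exact: (integrableM_bounded_support ci bi).
  by congr Rintegral; apply/funext => x; rewrite ReFM.
- have -> : ImF (fun x => f x * cco_average k psi x) =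
      (fun x => ReF f x * co_average k (ImF psi) x
         + ImF f x * co_average k (ReF psi) x).
    by apply/funext => x; rewrite ImFM.
  rewrite RintegralD//; last 2 first.
  - exact: (integrableM_bounded_support fr bi').
  - exact: (integrableM_bounded_support fi br').
  rewrite (average_duality kh fr bi) (average_duality kh fi br).
  rewrite -RintegralD//; last 2 first.
  - exact: (integrableM_bounded_support cr bi).
  - exact: (integrableM_bounded_support ci br).
  by congr Rintegral; apply/funext => x; rewrite ImFM.
Qed.

End pairing.

(** * Real test functions *)

Section test_functions.
Context {R : realType}.
Local Notation mu := (@lebesgue_measure R).
Implicit Types (f g k phi psi : R -> R).

Definition smooth_real f := forall (n : nat) (x : R), derivable (derive1n n f) x 1.

Lemma smooth_real_derivable f : smooth_real f -> forall x : R, derivable f x 1.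
Proof. by move=> sf; exact: (sf 0%N). Qed.

Lemma smooth_real_derive f : smooth_real f -> smooth_real (derive1 f).
Proof. by move=> sf n x; rewrite -derive1Sn; exact: sf. Qed.

(** Coinduction: a class of differentiable functions that is stable under
    derivation consists of smooth functions. *)
Lemma smooth_real_coind (P : (R -> R) -> Prop) :
  (forall f, P f -> (forall x : R, derivable f x 1) /\ P (derive1 f)) ->
  forall f, P f -> smooth_real f.
Proof.
move=> PS f Pf n; suff : P (derive1n n f) by move/PS => [].
by elim: n => // n IH; rewrite derive1nS; exact: (PS _ IH).2.
Qed.

Lemma derive1_add f g : (forall x : R, derivable f x 1) ->
  (forall x : R, derivable g x 1) ->
  derive1 (fun x => f x + g x) = (fun x => (derive1 f) x + (derive1 g) x).
Proof.
move=> df dg; apply/funext => x.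
by rewrite !derive1E; exact: (deriveD (df x) (dg x)).
Qed.

Lemma derive1_mul f g : (forall x : R, derivable f x 1) ->
  (forall x : R, derivable g x 1) ->
  derive1 (fun x => f x * g x) = (fun x => (derive1 f) x * g x + f x * (derive1 g) x).
Proof.
move=> df dg; apply/funext => x.
rewrite !derive1E; have -> := deriveM (df x) (dg x).
by rewrite /GRing.scale /= addrC [g x * _]mulrC.
Qed.

(** The derivative of a product is a sum of products, so sums have to be in the
    class to which coinduction is applied. *)
Inductive smooth_alg : (R -> R) -> Prop :=
| smooth_alg_gen f of smooth_real f : smooth_alg f
| smooth_alg_add f g of smooth_alg f & smooth_alg g :
    smooth_alg (fun x => f x + g x)
| smooth_alg_mul f g of smooth_alg f & smooth_alg g :
    smooth_alg (fun x => f x * g x).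

Lemma smooth_alg_smooth f : smooth_alg f -> smooth_real f.
Proof.
apply: smooth_real_coind => {}f.
elim=> {f} [f sf|f g sf [df Sf] sg [dg Sg]|f g sf [df Sf] sg [dg Sg]].
- split; first exact: smooth_real_derivable.
  by apply: smooth_alg_gen; exact: smooth_real_derive.
- split; first by move=> x; exact: (derivableD (df x) (dg x)).
  by rewrite derive1_add//; exact: smooth_alg_add.
- split; first by move=> x; exact: (derivableM (df x) (dg x)).
  by rewrite derive1_mul//; apply: smooth_alg_add; exact: smooth_alg_mul.
Qed.

Lemma smooth_realD f g : smooth_real f -> smooth_real g ->
  smooth_real (fun x => f x + g x).
Proof.
by move=> sf sg; apply: smooth_alg_smooth; apply: smooth_alg_add;
  exact: smooth_alg_gen.
Qed.

Lemma smooth_realM f g : smooth_real f -> smooth_real g ->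
  smooth_real (fun x => f x * g x).
Proof.
by move=> sf sg; apply: smooth_alg_smooth; apply: smooth_alg_mul;
  exact: smooth_alg_gen.
Qed.

Lemma smooth_real_cst (c : R) : smooth_real (fun=> c).
Proof.
apply: (@smooth_real_coind (fun f => exists c, f = fun=> c)); last by exists c.
move=> _ [d ->]; split; first by move=> x; exact: derivable_cst.
by exists 0; apply/funext => x; rewrite derive1_cst.
Qed.

Lemma is_derive_shift f (a x : R) : (forall x : R, derivable f x 1) ->
  is_derive x (1 : R) (fun y => f (y + a)) ((derive1 f) (x + a)).
Proof.
move=> df.
have dh : is_derive x (1 : R) (fun y : R => y + a) 1.
  by apply: is_derive_eq; rewrite addr0.
have dfx : is_derive (x + a) (1 : R) f ((derive1 f) (x + a)).
  by apply: DeriveDef; [exact: df|rewrite derive1E].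
have := @is_derive1_comp _ f (fun y : R => y + a) x _ _ dfx dh.
by rewrite mulr1.
Qed.

Lemma smooth_real_shift f (a : R) : smooth_real f ->
  smooth_real (fun x => f (x + a)).
Proof.
move=> sf.
apply: (@smooth_real_coind (fun g => exists2 f, smooth_real f & g = fun x => f (x + a))).
  move=> _ [g sg ->]; have d x := is_derive_shift a x (smooth_real_derivable sg).
  split; first by move=> x; have [] := d x.
  exists (derive1 g); first exact: smooth_real_derive.
  by apply/funext => x; rewrite derive1E; have [_ ->] := d x.
by exists f.
Qed.

Definition test_real phi := smooth_real phi /\
  exists N : R, forall x, N < `|x| -> phi x = 0.

Lemma test_real_derive phi : test_real phi -> test_real (derive1 phi).
Proof.
move=> [sp [N pN]]; split; first exact: smooth_real_derive.
exists N => x Nx; rewrite derive1E.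
rewrite (@near_eq_derive _ _ _ _ (cst 0)) ?derive_cst//.
have cn : {for x, continuous (fun y : R => `|y|)} by exact: norm_continuous.
near=> y; rewrite /= pN//; near: y.
exact: (@cvgr_gt _ _ _ _ _ _ cn N Nx).
Unshelve. all: by end_near. Qed.

Lemma test_realD phi psi : test_real phi -> test_real psi ->
  test_real (fun x => phi x + psi x).
Proof.
move=> [sp [N pN]] [sq [M qM]]; split; first exact: smooth_realD.
exists (Num.max N M) => x; rewrite gt_max => /andP[/pN -> /qM ->].
by rewrite addr0.
Qed.

Lemma test_realM f phi : smooth_real f -> test_real phi ->
  test_real (fun x => f x * phi x).
Proof.
move=> sf [sp [N pN]]; split; first exact: smooth_realM.
by exists N => x /pN ->; rewrite mulr0.
Qed.

Lemma test_real_shift (a : R) phi : test_real phi ->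
  test_real (fun x => phi (x + a)).
Proof.
move=> [sp [N pN]]; split; first exact: smooth_real_shift.
exists (N + `|a|) => x Nx; apply: pN.
have := ler_normB (x + a) a; rewrite addrK; lra.
Qed.

Lemma test_real_bounded phi : test_real phi ->
  exists N C, bounded_support N C phi.
Proof.
move=> [sp [N pN]].
have cp : continuous phi by apply: derivable_continuous; exact: smooth_real_derivable.
have NN : - `|N| <= `|N| by rewrite (@le_trans _ _ 0) ?oppr_le0.
have cn : {within `[- `|N|, `|N|], continuous (fun x => `|phi x|)}.
  apply: continuous_subspaceT => x.
  by apply: cvg_norm; exact: cp.
have [c _ cmax] := EVT_max NN cn.
exists `|N|, `|phi c|; split => //.
  exact: continuous_measurable_fun.
move=> x; rewrite indic_itvE -ler_norml.
have [xN|xN] := leP `|x| `|N|.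
  by rewrite mulr1; apply: cmax; rewrite in_itv /= -ler_norml.
by rewrite pN ?normr0 ?mulr0// (le_lt_trans (ler_norm _) xN).
Qed.

(** Differentiation under the integral sign; the derivative of the integrand is
    dominated by a bound of [derive1 psi] times the indicator of the support of
    the kernel. *)
Lemma co_average_derive h k psi (x : R) : kernel_on h k -> test_real psi ->
  is_derive x (1 : R) (co_average k psi) (co_average k (derive1 psi) x).
Proof.
move=> kh tp; have tp' := test_real_derive tp.
have [N [C bp]] := test_real_bounded tp.
have [N' [C' bp']] := test_real_bounded tp'.
have dp : forall x : R, derivable psi x 1 by apply: smooth_real_derivable; exact: tp.1.
pose F (y s : R) := k s * psi (y - s).
have dF (y s : R) : is_derive y (1 : R) (F ^~ s) (k s * (derive1 psi) (y - s)).
  have d1 := is_derive_shift (- s) y dp.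
  have := @is_deriveZ _ _ _ (fun z => psi (z - s)) (k s) y 1 _ d1.
  exact.
have pE y s : partial1of2 F y s = k s * (derive1 psi) (y - s).
  by rewrite partial1of2E; have [_ ->] := dF y s.
have Ix : `](x - 1), (x + 1)[%classic x by rewrite /= in_itv /=; apply/andP; split; lra.
have iF : forall y, `](x - 1), (x + 1)[%classic y ->
    mu.-integrable [set: R] (EFin \o F y).
  by move=> y _; exact: co_average_integrable kh bp.
have derF : forall (y s : R), `](x - 1), (x + 1)[%classic y -> [set: R] s ->
    derivable (F ^~ s) y 1.
  by move=> y s _ _; have [] := dF y s.
pose G s := C' * \1_(`[0, h] : set R) s.
have [_ C'0 bC'] := bp'.
have G0 s : 0 <= G s by rewrite mulr_ge0.
have iG : mu.-integrable [set: R] (EFin \o G).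
  by have := integrableZl measurableT C' (integrable_indic_itv 0 h); apply: eq_integrable.
have Gub : forall (y s : R), `](x - 1), (x + 1)[%classic y -> [set: R] s ->
    `|partial1of2 F y s| <= G s.
  move=> y s _ _; rewrite pE normrM mulrC; apply: ler_pM => //; last exact: kh.2.
  by apply: le_trans (bC' _) _; rewrite indic_itvE ler_piMr// lern1 leq_b1.
apply: DeriveDef.
  exact: (derivable_under_integral measurableT Ix iF derF G0 iG Gub).
rewrite -derive1E.
rewrite (differentiation_under_integral measurableT Ix iF derF G0 iG Gub).
by congr Rintegral; apply/funext => s; rewrite pE.
Qed.

Lemma co_average_derive1 h k psi : kernel_on h k -> test_real psi ->
  derive1 (co_average k psi) = co_average k (derive1 psi).
Proof.
move=> kh tp; apply/funext => x; rewrite derive1E.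
by have [_ ->] := co_average_derive x kh tp.
Qed.

Lemma test_real_co_average h k psi : kernel_on h k -> test_real psi ->
  test_real (co_average k psi).
Proof.
move=> kh tp; split.
  apply: (@smooth_real_coind (fun f =>
    exists2 psi, test_real psi & f = co_average k psi)); last by exists psi.
  move=> _ [phi tphi ->]; split.
    by move=> x; have [] := co_average_derive x kh tphi.
  exists (derive1 phi); first exact: test_real_derive.
  exact: (co_average_derive1 kh).
have [sp [N pN]] := tp; exists (N + `|h|) => x Nx.
rewrite /co_average (_ : (fun s => _) = cst 0) ?Rintegral_cst ?mul0r//.
apply/funext => s /=.
have := kh.2 s; rewrite indic_itvE.
case: andP => [[s0 sh] _|_]; last by rewrite normr_le0 => /eqP ->; rewrite mul0r.
rewrite pN ?mulr0//.
have := ler_normD (x - s) s; rewrite subrK.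
have := ler_norm h; rewrite (ger0_norm s0); lra.
Qed.

Lemma Rintegral_FTC (F f : R -> R) (h : R) : 0 < h ->
  (forall x : R, is_derive x (1 : R) F (f x)) -> continuous f ->
  \int[mu]_s (\1_(`[0, h] : set R) s * f s) = F h - F 0.
Proof.
move=> h0 dF cf.
have cF : continuous F by apply: derivable_continuous => x; have [] := dF x.
have -> : (fun s => \1_(`[0, h] : set R) s * f s) = f \_ `[0, h].
  apply/funext => s; rewrite patchE indicE.
  by case: (_ \in _); rewrite ?mul1r ?mul0r.
rewrite -Rintegral_mkcond /Rintegral (@continuous_FTC2 _ f F 0 h) //.
- exact: continuous_subspaceT.
- split.
  + by move=> x _; have [] := dF x.
  + by apply: cvg_at_right_filter; exact: cF.
  + by apply: cvg_at_left_filter; exact: cF.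
- by move=> x _; rewrite derive1E; have [_ ->] := dF x.
Qed.

End test_functions.

(** * The kernel of Taylor's formula and complex test functions *)

Section hat_kernel.
Context {R : realType}.
Local Notation mu := (@lebesgue_measure R).
Implicit Types (psi : R -> R).

(** The kernel of the integral remainder in Taylor's formula of order two with
    step [h], divided by [h]. *)
Definition hat (h : R) : R -> R := fun s => \1_(`[0, h] : set R) s * (1 - s / h).

Lemma kernel_on_hat (h : R) : 0 < h -> kernel_on h (hat h).
Proof.
move=> h0; split.
  apply: measurable_funM => //; apply: measurable_funB => //.
  exact: measurable_funM.
move=> s; rewrite /hat indic_itvE; case: andP => [[s0 sh]|_] /=; last first.
  by rewrite mul0r normr0.
rewrite mul1r.
have sh1 : 0 <= s / h <= 1 by rewrite divr_ge0 ?(ltW h0)//= ler_pdivrMr// mul1r.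
rewrite ger0_norm; lra.
Qed.

Lemma co_average_indic_derive (h x : R) psi : 0 < h -> test_real psi ->
  co_average (\1_(`[0, h] : set R)) (derive1 psi) x = psi x - psi (x - h).
Proof.
move=> h0 tp.
have dp : forall x : R, derivable psi x 1 by exact: smooth_real_derivable tp.1.
have cp' : continuous (derive1 psi).
  apply: derivable_continuous; apply: smooth_real_derivable.
  exact: smooth_real_derive tp.1.
have dF (s : R) : is_derive s (1 : R) (fun s => - psi (x - s)) (derive1 psi (x - s)).
  have d1 : is_derive s (1 : R) (fun s : R => x - s) (-1).
    by apply: is_derive_eq; lra.
  have d2 : is_derive (x - s) (1 : R) psi (derive1 psi (x - s)).
    by apply: DeriveDef; [exact: dp|rewrite derive1E].
  have d3 := @is_derive1_comp _ psi (fun s : R => x - s) s _ _ d2 d1.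
  have := is_deriveN d3; rewrite mulrN1 opprK; exact.
rewrite /co_average (Rintegral_FTC h0 dF).
  by rewrite subr0 opprK addrC.
move=> s; apply: continuous_comp; last exact: cp'.
by apply: continuousB; [exact: cst_continuous|exact: cvg_id].
Qed.

(** Integration by parts, as the fundamental theorem of calculus applied to
    s |-> - (1 - s / h) psi (x - s). *)
Lemma co_average_hat_derive (h x : R) psi : 0 < h -> test_real psi ->
  co_average (hat h) (derive1 psi) x =
  psi x - h^-1 * co_average (\1_(`[0, h] : set R)) psi x.
Proof.
move=> h0 tp; have tp' := test_real_derive tp.
have dp : forall x : R, derivable psi x 1 by exact: smooth_real_derivable tp.1.
have cp : continuous psi by exact: derivable_continuous.
have cp' : continuous (derive1 psi).
  apply: derivable_continuous; apply: smooth_real_derivable.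
  exact: smooth_real_derive tp.1.
have dF (s : R) : is_derive s (1 : R) (fun s => - ((1 - s / h) * psi (x - s)))
    (h^-1 * psi (x - s) + (1 - s / h) * derive1 psi (x - s)).
  have d1 : is_derive s (1 : R) (fun s : R => x - s) (-1).
    by apply: is_derive_eq; lra.
  have d2 : is_derive (x - s) (1 : R) psi (derive1 psi (x - s)).
    by apply: DeriveDef; [exact: dp|rewrite derive1E].
  have d3 := @is_derive1_comp _ psi (fun s : R => x - s) s _ _ d2 d1.
  have d4 : is_derive s (1 : R) (fun s : R => 1 - s / h) (- h^-1).
    by apply: is_derive_eq; rewrite /GRing.scale /=; ring.
  have := is_deriveN (is_deriveM d4 d3).
  by move=> /is_derive_eq; apply; rewrite /GRing.scale /=; ring.
have cs : continuous (fun s : R => x - s).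
  by move=> s; apply: continuousB; [exact: cst_continuous|exact: cvg_id].
have cf : continuous (fun s => h^-1 * psi (x - s) + (1 - s / h) * derive1 psi (x - s)).
  have cD (f g : R -> R) : continuous f -> continuous g ->
    continuous (fun s => f s + g s).
    by move=> c1 c2 s; exact: (continuousD (c1 s) (c2 s)).
  have cM (f g : R -> R) : continuous f -> continuous g ->
    continuous (fun s => f s * g s).
    by move=> c1 c2 s; exact: (continuousM (c1 s) (c2 s)).
  have cc (f : R -> R) : continuous f -> continuous (fun s => f (x - s)).
    by move=> c1 s; apply: continuous_comp; [exact: cs|exact: c1].
  have cl : continuous (fun s : R => 1 - s / h).
    by apply: derivable_continuous => s; exact: derivableB.
  apply: cD; apply: cM; [exact: cst_continuous|exact: cc|exact: cl|exact: cc].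
have := Rintegral_FTC h0 dF cf.
have [N [C bp]] := test_real_bounded tp.
have [N' [C' bp']] := test_real_bounded tp'.
have i1 := co_average_integrable x (kernel_on_indic h) bp.
have i2 := co_average_integrable x (kernel_on_hat h0) bp'.
have -> : (fun s => \1_(`[0, h] : set R) s *
    (h^-1 * psi (x - s) + (1 - s / h) * derive1 psi (x - s))) =
    (fun s => h^-1 * (\1_(`[0, h] : set R) s * psi (x - s)) +
       hat h s * derive1 psi (x - s)).
  by apply/funext => s; rewrite /hat; ring.
rewrite RintegralD//; last first.
  by have := integrableZl measurableT h^-1 i1; apply: eq_integrable.
rewrite RintegralZl// -/(co_average _ psi x) -/(co_average _ (derive1 psi) x).
rewrite divff ?gt_eqF// subrr !mul0r !subr0 mul1r oppr0 opprK add0r => <-.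
ring.
Qed.

End hat_kernel.

Section complex_test_functions.
Context {R : realType}.
Local Notation mu := (@lebesgue_measure R).
Local Open Scope complex_scope.
Implicit Types (a f phi psi : R -> R[i]).

Lemma smoothP f : smooth f <-> smooth_real (ReF f) /\ smooth_real (ImF f).
Proof.
split=> [sf|[sr si] n x]; last by split; [exact: sr|exact: si].
by split=> n x; have [] := sf n x.
Qed.

(** Compactness of the support amounts to vanishing outside a bounded interval,
    which can be checked on the components. *)
Lemma test_functionP phi :
  test_function phi <-> test_real (ReF phi) /\ test_real (ImF phi).
Proof.
split=> [[/smoothP[sr si] cp]|[[sr [N rN]] [si [M iM]]]].
  have [N pN] : exists N : R, forall x, N < `|x| -> phi x = 0.
    have [N [_ bN]] := compact_bounded cp.
    exists (N + 1) => x Nx; apply: contrapT => px.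
    have xc : closure [set x | phi x != 0] x.
      by apply: subset_closure => /=; apply/eqP.
    have := bN (N + 1); rewrite ltrDl ltr01 => /(_ isT x xc).
    by rewrite /= leNgt Nx.
  by split; split => //; exists N => x /pN; rewrite /ReF /ImF => ->.
split; first exact/smoothP.
pose B := Num.max N M.
apply: (subclosed_compact _ (@segment_compact _ (- B) B)).
  exact: closed_closure.
have cl : closed (`[- B, B]%classic : set R) by exact: itv_closed.
rewrite [X in _ `<=` X](closure_id _).1//; apply: closureS => x /= px.
rewrite in_itv /= -ler_norml leNgt; apply/negP; rewrite gt_max => /andP[Nx Mx].
move: px; apply/negP; rewrite negbK; apply/eqP.
have := rN _ Nx; have := iM _ Mx; rewrite /ReF /ImF.
by case: (phi x) => b c /= -> ->.
Qed.

Lemma cderiven1E f x :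
  cderiven 1 f x = derive1 (ReF f) x +i* derive1 (ImF f) x.
Proof. by []. Qed.

Lemma cderivenS n f : cderiven 1 (cderiven n f) = cderiven n.+1 f.
Proof. by []. Qed.

Lemma smooth_cderiven n f : smooth f -> smooth (cderiven n f).
Proof.
elim: n => [|n IH] sf; first by apply/smoothP; move/smoothP: sf.
have /smoothP[sr si] := IH sf; apply/smoothP; split.
- exact: (smooth_real_derive sr).
- exact: (smooth_real_derive si).
Qed.

Lemma test_cderiven1 phi : test_function phi -> test_function (cderiven 1 phi).
Proof.
move=> /test_functionP[tr ti]; apply/test_functionP; split.
- exact: (test_real_derive tr).
- exact: (test_real_derive ti).
Qed.

Lemma test_cbounded phi : test_function phi -> cbounded_support phi.
Proof.
move=> /test_functionP[/test_real_bounded[N [C b1]] /test_real_bounded[M [D b2]]].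
have [m1 C0 l1] := b1; have [m2 D0 l2] := b2.
have aux N' C' (f : R -> R) : measurable_fun [set: R] f -> 0 <= C' ->
   (forall x, `|f x| <= C' * \1_(`[- N', N'] : set R) x) ->
   N' <= Num.max N M -> C' <= Num.max C D ->
   bounded_support (Num.max N M) (Num.max C D) f.
  move=> mf C'0 fle NN CC; split => //; first exact: le_trans CC.
  move=> x; apply: le_trans (fle x) _; apply: ler_pM => //.
  rewrite !indic_itvE ler_nat; case: andP => //= -[x1 x2].
  by rewrite (_ : _ && _ = true) //; apply/andP; split; lra.
exists (Num.max N M), (Num.max C D); split.
- by apply: (aux N C) => //; rewrite le_max lexx.
- by apply: (aux M D) => //; rewrite le_max lexx orbT.
Qed.

Lemma testD phi psi : test_function phi -> test_function psi ->
  test_function (fun x => phi x + psi x).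
Proof.
move=> /test_functionP[r1 i1] /test_functionP[r2 i2]; apply/test_functionP.
have -> : ReF (fun x => phi x + psi x) = (fun x => ReF phi x + ReF psi x).
  by apply/funext => x; rewrite ReFD.
have -> : ImF (fun x => phi x + psi x) = (fun x => ImF phi x + ImF psi x).
  by apply/funext => x; rewrite ImFD.
by split; exact: test_realD.
Qed.

Lemma smooth_cst (z : R[i]) : smooth (fun=> z).
Proof. by apply/smoothP; split; exact: smooth_real_cst. Qed.

Lemma ReFM_ext f g : ReF (fun x => f x * g x) =
  (fun x => ReF f x * ReF g x + (-1) * ImF f x * ImF g x).
Proof. by apply/funext => x; rewrite ReFM mulN1r mulNr. Qed.

Lemma ImFM_ext f g : ImF (fun x => f x * g x) =
  (fun x => ReF f x * ImF g x + 1 * ImF f x * ReF g x).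
Proof. by apply/funext => x; rewrite ImFM mul1r. Qed.

Lemma derive1_mul_add (c : R) (f1 g1 f2 g2 : R -> R) :
  smooth_real f1 -> smooth_real g1 -> smooth_real f2 -> smooth_real g2 ->
  derive1 (fun x => f1 x * g1 x + c * f2 x * g2 x) =
  (fun x => derive1 f1 x * g1 x + f1 x * derive1 g1 x
      + c * (derive1 f2 x * g2 x + f2 x * derive1 g2 x)).
Proof.
move=> s1 t1 s2 t2; apply/funext => x.
have D (f : R -> R) : smooth_real f -> is_derive x (1 : R) f (derive1 f x).
  by move=> sf; apply: DeriveDef; [exact: (sf 0%N)|rewrite derive1E].
have D1 := D _ s1; have D2 := D _ t1; have D3 := D _ s2; have D4 := D _ t2.
have E : is_derive x (1 : R) (fun x => f1 x * g1 x + c * f2 x * g2 x)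
   (derive1 f1 x * g1 x + f1 x * derive1 g1 x
      + c * (derive1 f2 x * g2 x + f2 x * derive1 g2 x)).
  by apply: is_derive_eq; rewrite /GRing.scale /=; ring.
by rewrite derive1E; have [_ ->] := E.
Qed.

Lemma testM a phi : smooth a -> test_function phi ->
  test_function (fun x => a x * phi x).
Proof.
move=> /smoothP[ar ai] /test_functionP[r2 i2]; apply/test_functionP.
have c1 (c : R) (f g : R -> R) : smooth_real f -> test_real g ->
    test_real (fun x => c * f x * g x).
  by move=> sf tg; exact: (test_realM (smooth_realM (@smooth_real_cst R c) sf) tg).
rewrite ReFM_ext ImFM_ext; split.
- exact: (test_realD (test_realM ar r2) (c1 (-1) _ _ ai i2)).
- exact: (test_realD (test_realM ar i2) (c1 1 _ _ ai r2)).
Qed.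

Lemma cderiven1M a phi : smooth a -> smooth phi ->
  cderiven 1 (fun x => a x * phi x) =
  (fun x => cderiven 1 a x * phi x + a x * cderiven 1 phi x).
Proof.
move=> /smoothP[ar ai] /smoothP[pr pi]; apply/funext => x.
rewrite !cderiven1E ReFM_ext ImFM_ext.
rewrite (derive1_mul_add (-1) ar pr ai pi) (derive1_mul_add 1 ar pi ai pr).
rewrite /ReF /ImF.
by case: (a x) => a1 a2; case: (phi x) => p1 p2; apply/eqP; rewrite eq_complex /=;
  apply/andP; split; apply/eqP; ring.
Qed.

Lemma test_shift (b : R) psi : test_function psi ->
  test_function (fun x => psi (x + b)).
Proof.
move=> /test_functionP[r2 i2]; apply/test_functionP; split.
- exact: (test_real_shift b r2).
- exact: (test_real_shift b i2).
Qed.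

Lemma test_cco_average (h : R) k psi : kernel_on h k -> test_function psi ->
  test_function (cco_average k psi).
Proof.
move=> kh /test_functionP[r2 i2]; apply/test_functionP; split.
- exact: (test_real_co_average kh r2).
- exact: (test_real_co_average kh i2).
Qed.

Lemma cderiven1_hat (h : R) psi : 0 < h -> test_function psi ->
  cderiven 1 (cco_average (hat h) psi) =
  (fun x => psi x + (- h^-1)%:C * cco_average (\1_(`[0, h] : set R)) psi x).
Proof.
move=> h0 /test_functionP[r2 i2]; apply/funext => x; rewrite cderiven1E.
have kh := kernel_on_hat h0.
rewrite (co_average_derive1 kh r2) (co_average_derive1 kh i2).
rewrite !co_average_hat_derive// /ReF /ImF /cco_average.
by case: (psi x) => p1 p2; apply/eqP; rewrite eq_complex /=;
  apply/andP; split; apply/eqP; ring.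
Qed.

(** Taylor's formula u' = (u (. + h) - u) / h - T u'', with T u the average of [u]
    against [hat h], in transposed form: [cco_average (hat h)] is the transpose
    of T, and derivatives and translations change sides. *)
Lemma cderiven2_hat (h : R) psi : 0 < h -> test_function psi ->
  cderiven 1 (cderiven 1 (cco_average (hat h) psi)) =
  (fun x => cderiven 1 psi x + (- h^-1)%:C * (psi x + (-1) * psi (x - h))).
Proof.
move=> h0 tp; have /test_functionP[r2 i2] := tp.
rewrite (cderiven1_hat h0 tp); apply/funext => x.
have kh := kernel_on_indic h.
have aux (f : R -> R) : test_real f ->
    derive1 (fun x => f x + (- h^-1) * co_average (\1_(`[0, h] : set R)) f x) x =
    derive1 f x + (- h^-1) * (f x - f (x - h)).
  move=> tf; have d1 := smooth_real_derivable tf.1.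
  have tc := test_real_co_average kh tf.
  have dc := smooth_real_derivable tc.1.
  have dz := smooth_real_derivable (@smooth_real_cst R (- h^-1)).
  have dm := smooth_real_derivable (smooth_realM (@smooth_real_cst R (- h^-1)) tc.1).
  rewrite derive1_add// derive1_mul// derive1_cst mul0r add0r.
  by rewrite (co_average_derive1 kh tf) co_average_indic_derive.
rewrite cderiven1E.
have -> : ReF (fun x => psi x + (- h^-1)%:C * cco_average (\1_(`[0, h] : set R)) psi x)
  = (fun x => ReF psi x + (- h^-1) * co_average (\1_(`[0, h] : set R)) (ReF psi) x).
  by apply/funext => y; rewrite /ReF /cco_average; case: (psi y) => b c /=; ring.
have -> : ImF (fun x => psi x + (- h^-1)%:C * cco_average (\1_(`[0, h] : set R)) psi x)
  = (fun x => ImF psi x + (- h^-1) * co_average (\1_(`[0, h] : set R)) (ImF psi) x).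
  by apply/funext => y; rewrite /ImF /cco_average; case: (psi y) => b c /=; ring.
rewrite !aux// cderiven1E /ReF /ImF.
by case: (psi x) => b c; case: (psi (x - h)) => d e; apply/eqP;
  rewrite eq_complex /=; apply/andP; split; apply/eqP; ring.
Qed.

End complex_test_functions.

(** * Weak derivatives *)

Section weak_derivatives.
Context {R : realType} (p : \bar R) (p1 : (1 <= p)%E).
Local Open Scope complex_scope.
Implicit Types (f g a u v W V phi psi : R -> R[i]).

(** Keeping the bound as a real number makes estimates compose without side
    conditions on finiteness. *)
Definition Lp_bound f (r : R) := cmeasurable f /\ (Lpnorm p f <= r%:E)%E.

Lemma Lp_bound_inLp f r : Lp_bound f r -> inLp p f.
Proof. by move=> [mf fr]; split => //; apply: le_lt_trans fr _; rewrite ltry. Qed.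

Lemma fineK_Lpnorm f : inLp p f -> (fine (Lpnorm p f))%:E = Lpnorm p f.
Proof. by move=> [_ fy]; rewrite fineK// ge0_fin_numE// Lpnorm_ge0. Qed.

Lemma inLp_Lp_bound f : inLp p f -> Lp_bound f (fine (Lpnorm p f)).
Proof. by move=> fp; split; [exact: fp.1|rewrite fineK_Lpnorm]. Qed.

Lemma Lp_bound_fine f r : Lp_bound f r -> fine (Lpnorm p f) <= r.
Proof.
by move=> fr; rewrite -lee_fin fineK_Lpnorm; [exact: fr.2|exact: Lp_bound_inLp fr].
Qed.

Lemma Lp_bound_le f r s : r <= s -> Lp_bound f r -> Lp_bound f s.
Proof. by move=> rs [mf fr]; split => //; apply: le_trans fr _; rewrite lee_fin. Qed.

Lemma Lp_boundD f g r s : Lp_bound f r -> Lp_bound g s ->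
  Lp_bound (fun x => f x + g x) (r + s).
Proof.
move=> [mf fr] [mg gs]; split; first exact: cmeasurableD.
by apply: le_trans (Lpnorm_add p1 mf mg) _; rewrite EFinD leeD.
Qed.

Lemma Lp_boundM a f c r : cmeasurable a -> 0 <= c ->
  (forall x, modulus (a x) <= c) ->
  Lp_bound f r -> Lp_bound (fun x => a x * f x) (c * r).
Proof.
move=> ma c0 ac [mf fr]; have maf := cmeasurableM ma mf; split => //.
apply: le_trans (Lpnorm_le_scale p1 c0 maf mf _) _; last first.
  by rewrite EFinM lee_pmul// Lpnorm_ge0.
by move=> x; rewrite modulusM ler_wpM2r// modulus_ge0.
Qed.

Lemma Lp_boundZ (z : R[i]) f r : Lp_bound f r ->
  Lp_bound (fun x => z * f x) (modulus z * r).
Proof.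
apply: Lp_boundM => //; first exact: cmeasurable_cst.
exact: modulus_ge0.
Qed.

Lemma Lp_bound_shift (b : R) f r : Lp_bound f r ->
  Lp_bound (fun x => f (x + b)) r.
Proof.
move=> [mf fr]; split; first exact: cmeasurable_shift.
exact: le_trans (Lpnorm_shift b p1 mf) fr.
Qed.

Lemma Lp_bound_caverage (h : R) (k : R -> R) f r : 0 < h -> kernel_on h k ->
  Lp_bound f r -> Lp_bound (caverage k f) (h * r).
Proof.
move=> h0 kh fr; have [[mc _] le] := caverage_inLp p1 h0 kh (Lp_bound_inLp fr).
split => //; apply: le_trans le _; rewrite EFinM; apply: lee_pmul => //.
- by rewrite lee_fin ltW.
- exact: Lpnorm_ge0.
- exact: fr.2.
Qed.

Lemma Lp_bound0 : Lp_bound (fun=> 0) 0.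
Proof.
split; first exact: cmeasurable_cst.
rewrite /Lpnorm (_ : (fun x : R => _) = cst 0%E) ?Lnorm0//.
  by case: (p) p1 => // r; rewrite lee_fin => r1; rewrite gt_eqF// lte_fin; lra.
by apply/funext => x; rewrite modulusE /= expr0n /= addr0 sqrtr0.
Qed.

Lemma Lp_bound_sum (n : nat) (F : nat -> R -> R[i]) (r : nat -> R) :
  (forall k, (k < n)%N -> Lp_bound (F k) (r k)) ->
  Lp_bound (fun x => \sum_(k < n) F k x) (\sum_(k < n) r k).
Proof.
elim: n => [_|n IH H].
  rewrite big_ord0 (_ : (fun x => _) = fun=> 0); first exact: Lp_bound0.
  by apply/funext => x; rewrite big_ord0.
rewrite big_ord_recr (_ : (fun x => _) = fun x => \sum_(k < n) F k x + F n x).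
  apply: Lp_boundD; last exact: H.
  by apply: IH => k kn; apply: H; exact: leqW.
by apply/funext => x; rewrite big_ord_recr.
Qed.

Definition weak_derivative f g := forall phi, test_function phi ->
  dist_of f (cderiven 1 phi) = - dist_of g phi.

Lemma dist_of_mul a f phi :
  dist_of (fun x => a x * f x) phi = dist_of f (fun x => a x * phi x).
Proof.
by rewrite /dist_of; congr cintegral; apply/funext => x; rewrite mulrAC mulrC mulrA.
Qed.

Lemma weak_derivativeD f f' g g' : inLp p f -> inLp p f' -> inLp p g ->
  inLp p g' -> weak_derivative f f' -> weak_derivative g g' ->
  weak_derivative (fun x => f x + g x) (fun x => f' x + g' x).
Proof.
move=> fp fp' gp gp' wf wg phi tp.
have b := test_cbounded tp; have b' := test_cbounded (test_cderiven1 tp).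
by rewrite (dist_ofDl p1 fp gp b') (dist_ofDl p1 fp' gp' b) wf// wg// opprD.
Qed.

(** Test the weak derivative of [f] against [a * phi]. *)
Lemma weak_derivativeM a f g (c c' : R) : smooth a -> 0 <= c -> 0 <= c' ->
  (forall x, modulus (a x) <= c) -> (forall x, modulus (cderiven 1 a x) <= c') ->
  inLp p f -> inLp p g -> weak_derivative f g ->
  weak_derivative (fun x => a x * f x) (fun x => cderiven 1 a x * f x + a x * g x).
Proof.
move=> sa c0 c'0 ac ac' fp gp wfg phi tp.
have sa' := smooth_cderiven 1 sa.
have b := test_cbounded tp.
have tap := testM sa tp; have tap' := testM sa (test_cderiven1 tp).
have ta'p := testM sa' tp.
have agp := Lp_bound_inLp
  (Lp_boundM (smooth_cmeasurable sa) c0 ac (inLp_Lp_bound gp)).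
have a'fp := Lp_bound_inLp
  (Lp_boundM (smooth_cmeasurable sa') c'0 ac' (inLp_Lp_bound fp)).
rewrite (dist_ofDl p1 a'fp agp b) !dist_of_mul.
have := wfg _ tap; rewrite cderiven1M//; last exact: tp.1.
rewrite (dist_ofDr p1 fp (test_cbounded ta'p) (test_cbounded tap')).
by move=> /(canRL (addKr _)) ->; rewrite opprD addrC.
Qed.

Lemma weak_derivative_sum (n : nat) (F G : nat -> R -> R[i]) :
  (forall k, (k < n)%N ->
     [/\ inLp p (F k), inLp p (G k) & weak_derivative (F k) (G k)]) ->
  [/\ inLp p (fun x => \sum_(k < n) F k x), inLp p (fun x => \sum_(k < n) G k x) &
    weak_derivative (fun x => \sum_(k < n) F k x) (fun x => \sum_(k < n) G k x)].
Proof.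
move=> H.
have iF m : (m <= n)%N -> inLp p (fun x => \sum_(k < m) F k x).
  move=> mn; apply: Lp_bound_inLp.
  apply: (@Lp_bound_sum m F (fun k => fine (Lpnorm p (F k)))) => k km.
  by apply: inLp_Lp_bound; have [] := H k (leq_trans km mn).
have iG m : (m <= n)%N -> inLp p (fun x => \sum_(k < m) G k x).
  move=> mn; apply: Lp_bound_inLp.
  apply: (@Lp_bound_sum m G (fun k => fine (Lpnorm p (G k)))) => k km.
  by apply: inLp_Lp_bound; have [] := H k (leq_trans km mn).
split; [exact: iF|exact: iG|].
suff : forall m, (m <= n)%N -> weak_derivative
    (fun x => \sum_(k < m) F k x) (fun x => \sum_(k < m) G k x).
  by apply.
elim=> [_|m IH mn] phi tp.
  have b := test_cbounded tp; have b' := test_cbounded (test_cderiven1 tp).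
  have z psi : cbounded_support psi -> dist_of (fun x => \sum_(k < 0) F k x) psi = 0.
    move=> bp; rewrite (_ : (fun x => _) = fun x => 0 * (fun=> 0) x).
      by rewrite (dist_ofZl 0 p1 (Lp_bound_inLp Lp_bound0) bp) mul0r.
    by apply/funext => x; rewrite big_ord0 mul0r.
  have -> : (fun x => \sum_(k < 0) G k x) = (fun x => \sum_(k < 0) F k x).
    by apply/funext => x; rewrite !big_ord0.
  by rewrite !z// oppr0.
have [fp gp w] := H m mn.
have E (K : nat -> R -> R[i]) : (fun x => \sum_(k < m.+1) K k x) =
    (fun x => \sum_(k < m) K k x + K m x).
  by apply/funext => x; rewrite big_ord_recr.
rewrite !E; apply: weak_derivativeD => //; [exact/iF/ltnW|exact/iG/ltnW|].
exact/IH/ltnW.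
Qed.

(** If [g] stands for T u'' in Taylor's formula (see [cderiven2_hat]), then the
    formula gives a function that represents u'. *)
Lemma weak_derivative_of_dual (h : R) u g : 0 < h -> inLp p u -> inLp p g ->
  (forall psi, test_function psi ->
    dist_of u (cderiven 1 (cderiven 1 (cco_average (hat h) psi))) = dist_of g psi) ->
  weak_derivative u
    (fun x => (-1) * g x + (- h^-1)%:C * (u x + (-1) * u (x + h))).
Proof.
move=> h0 up gp dual psi tp.
have tp' := test_cderiven1 tp.
have tps : test_function (fun x => psi (x - h)) := test_shift (- h) tp.
have tm := testM (@smooth_cst R (-1)) tps.
have tD := testD tp tm.
have tZ := testM (@smooth_cst R (- h^-1)%:C) tD.
have b := test_cbounded tp.
have usp := Lp_bound_inLp (Lp_bound_shift h (inLp_Lp_bound up)).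
have nusp := Lp_bound_inLp (Lp_boundZ (-1) (inLp_Lp_bound usp)).
have dup := Lp_bound_inLp (Lp_boundD (inLp_Lp_bound up) (inLp_Lp_bound nusp)).
have dzp := Lp_bound_inLp (Lp_boundZ (- h^-1)%:C (inLp_Lp_bound dup)).
have ngp := Lp_bound_inLp (Lp_boundZ (-1) (inLp_Lp_bound gp)).
have := dual _ tp; rewrite (cderiven2_hat h0 tp).
rewrite (dist_ofDr p1 up (test_cbounded tp') (test_cbounded tZ)).
rewrite (dist_ofZr _ p1 up (test_cbounded tD)).
rewrite (dist_ofDr p1 up b (test_cbounded tm)).
rewrite (dist_ofZr _ p1 up (test_cbounded tps)).
rewrite (dist_of_shift h up.1 (smooth_cmeasurable tp.1)).
rewrite (dist_ofDl p1 ngp dzp b) (dist_ofZl _ p1 gp b) (dist_ofZl _ p1 dup b).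
rewrite (dist_ofDl p1 up nusp b) (dist_ofZl _ p1 usp b).
move=> <-; ring.
Qed.

End weak_derivatives.

(** * Weak derivatives of solutions *)

Section solution.
Context {R : realType} (p : \bar R) (p1 : (1 <= p)%E).
Local Open Scope complex_scope.
Implicit Types (f g a u v W V phi psi : R -> R[i]).

Lemma modulus_le_supnorm f (c : R) x : (supnorm f <= c%:E)%E -> modulus (f x) <= c.
Proof.
move=> fc; rewrite -lee_fin; apply: le_trans fc.
by apply: ereal_sup_ubound; exists x.
Qed.

Lemma dist_solutionE W V u : dist_solution W V u ->
  forall phi, test_function phi ->
  dist_of u (cderiven 1 (cderiven 1 phi)) =
  - dist_of u (cderiven 1 (fun x => W x * phi x)) + dist_of u (fun x => V x * phi x).
Proof.
move=> sol phi tp; have := sol phi tp.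
by rewrite /dist_add /dist_mul /dist_derivn /= /dist_derive opprK.
Qed.

Lemma modulusN1 : modulus (-1 : R[i]) = 1.
Proof. by rewrite modulusN (@modulus_nat R 1%N). Qed.

(** Let T* psi be the average of psi against [hat h] that transposes T.  Testing
    the equation with T* psi expresses T u'' by pairings of u with T* psi and its
    first derivative psi - S psi / h, where S is the average over a window of
    length [h].  No derivative of psi remains, so these pairings are given by
    functions.  The norm of the result depends on [c], which bounds the
    derivative of [W]. *)
Lemma solution_weak_derivative (c : R) W V u : 0 <= c -> smooth W -> smooth V ->
  (forall x, modulus (W x) <= 1) -> (forall x, modulus (cderiven 1 W x) <= c) ->
  (forall x, modulus (V x) <= 1) -> inLp p u -> dist_solution W V u ->
  exists2 v, inLp p v & weak_derivative u v.
Proof.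
move=> c0 sW sV W1 W'c V1 up sol.
have h0 : 0 < 2^-1 :> R by rewrite invr_gt0.
pose h : R := 2^-1; pose H := hat h; pose S : R -> R := \1_(`[0, h] : set R).
have kH : kernel_on h H by exact: kernel_on_hat.
have kS : kernel_on h S by exact: kernel_on_indic.
have sW' := smooth_cderiven 1 sW.
have bu := inLp_Lp_bound up.
have bWu := Lp_boundM p1 (smooth_cmeasurable sW) ler01 W1 bu.
have bVu := Lp_boundM p1 (smooth_cmeasurable sV) ler01 V1 bu.
have bW'u := Lp_boundM p1 (smooth_cmeasurable sW') c0 W'c bu.
have bA1 := Lp_bound_caverage p1 h0 kH bW'u.
have bA2 := Lp_bound_caverage p1 h0 kS bWu.
have bA3 := Lp_bound_caverage p1 h0 kH bVu.
set A1 := caverage _ _ in bA1; set A2 := caverage _ _ in bA2.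
set A3 := caverage _ _ in bA3.
pose z : R[i] := (- h^-1)%:C.
have bz := Lp_boundZ p1 (- z) bA2.
have bnW := Lp_boundZ p1 (-1) bWu.
have bnA1 := Lp_boundZ p1 (-1) bA1.
have b4 := Lp_boundD p1 bnW bz.
have b5 := Lp_boundD p1 bnA1 b4.
have b6 := Lp_boundD p1 b5 bA3.
set g := (fun x => _) in b6.
have gp := Lp_bound_inLp b6.
have bus := Lp_boundZ p1 (-1) (Lp_bound_shift p1 h bu).
have bD := Lp_boundZ p1 z (Lp_boundD p1 bu bus).
exists (fun x => (-1) * g x + z * (u x + (-1) * u (x + h))).
  exact: Lp_bound_inLp (Lp_boundD p1 (Lp_boundZ p1 (-1) b6) bD).
apply: (weak_derivative_of_dual p1) => // psi tp.
have tphi : test_function (cco_average H psi) := test_cco_average kH tp.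
have tS : test_function (cco_average S psi) := test_cco_average kS tp.
have bp := test_cbounded tp.
rewrite (dist_solutionE sol tphi).
rewrite (cderiven1M sW tphi.1) cderiven1_hat// -/H -/S -/z.
have tzS := testM (@smooth_cst R z) tS.
have tsum := testD tp tzS.
rewrite (dist_ofDr p1 up (test_cbounded (testM sW' tphi))
  (test_cbounded (testM sW tsum))).
rewrite -!dist_of_mul.
have Wup := Lp_bound_inLp bWu.
rewrite (dist_ofDr p1 Wup bp (test_cbounded tzS)) (dist_ofZr _ p1 Wup (test_cbounded tS)).
have dual f r k : kernel_on h k -> Lp_bound p f r ->
    dist_of f (cco_average k psi) = dist_of (caverage k f) psi.
  move=> kk fr; apply: (dist_of_cco_average p1 h0 kk (Lp_bound_inLp fr) bp).
  by apply: test_cbounded; exact: test_cco_average kk tp.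
rewrite (dual _ _ _ kH bW'u) (dual _ _ _ kS bWu) (dual _ _ _ kH bVu).
rewrite -/A1 -/A2 -/A3.
rewrite (dist_ofDl p1 (Lp_bound_inLp b5) (Lp_bound_inLp bA3) bp).
rewrite (dist_ofDl p1 (Lp_bound_inLp bnA1) (Lp_bound_inLp b4) bp).
rewrite (dist_ofDl p1 (Lp_bound_inLp bnW) (Lp_bound_inLp bz) bp).
rewrite (dist_ofZl _ p1 (Lp_bound_inLp bA1) bp).
rewrite (dist_ofZl _ p1 (Lp_bound_inLp bWu) bp).
rewrite (dist_ofZl _ p1 (Lp_bound_inLp bA2) bp).
by rewrite !mulN1r mulNr !opprD.
Qed.

(** Once [v] represents u', the right-hand side of the equation is the function
    W v + V u, of norm at most r + 1, and Taylor's formula with step h = 1/2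
    represents u' anew, with norm at most (r + 1) h + 2 / h.  The derivative of
    [W] no longer enters. *)
Lemma weak_derivative_improve (r : R) W V u v : smooth W -> smooth V ->
  (forall x, modulus (W x) <= 1) -> (forall x, modulus (V x) <= 1) ->
  dist_solution W V u -> Lp_bound p u 1 -> Lp_bound p v r ->
  weak_derivative u v ->
  exists2 v', Lp_bound p v' (2^-1 * r + 9 / 2) & weak_derivative u v'.
Proof.
move=> sW sV W1 V1 sol bu bv wuv.
have h0 : 0 < 2^-1 :> R by rewrite invr_gt0.
pose h : R := 2^-1; pose H := hat h.
have kH : kernel_on h H by exact: kernel_on_hat.
have up := Lp_bound_inLp bu; have vp := Lp_bound_inLp bv.
have bWv := Lp_boundM p1 (smooth_cmeasurable sW) ler01 W1 bv.
have bVu := Lp_boundM p1 (smooth_cmeasurable sV) ler01 V1 bu.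
have bs := Lp_boundD p1 bWv bVu.
have bA := Lp_bound_caverage p1 h0 kH bs.
set g := caverage _ _ in bA.
pose z : R[i] := (- h^-1)%:C.
have bus := Lp_boundZ p1 (-1) (Lp_bound_shift p1 h bu).
have bD := Lp_boundZ p1 z (Lp_boundD p1 bu bus).
exists (fun x => (-1) * g x + z * (u x + (-1) * u (x + h))).
  apply: Lp_bound_le (Lp_boundD p1 (Lp_boundZ p1 (-1) bA) bD).
  rewrite modulusN1 modulus_real normrN ger0_norm ?invr_ge0 ?(ltW h0)//.
  rewrite /h invrK; lra.
apply: (weak_derivative_of_dual p1) => //; first exact: Lp_bound_inLp bA.
move=> psi tp.
have tphi : test_function (cco_average H psi) := test_cco_average kH tp.
have bp := test_cbounded tp.
rewrite (dist_solutionE sol tphi) wuv; last exact: testM.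
rewrite opprK -!dist_of_mul.
rewrite -(dist_ofDl p1 (Lp_bound_inLp bWv) (Lp_bound_inLp bVu) (test_cbounded tphi)).
exact: (dist_of_cco_average p1 h0 kH (Lp_bound_inLp bs) bp (test_cbounded tphi)).
Qed.

(** The improvement halves the excess over 9, the fixed point of
    r |-> r / 2 + 9 / 2, so finitely many steps bring the norm below 10, whatever
    the starting value. *)
Lemma solution_weak_derivative_bounded (c : R) W V u : 0 <= c ->
  smooth W -> smooth V ->
  (forall x, modulus (W x) <= 1) -> (forall x, modulus (cderiven 1 W x) <= c) ->
  (forall x, modulus (V x) <= 1) -> Lp_bound p u 1 -> dist_solution W V u ->
  exists2 v, Lp_bound p v 10 & weak_derivative u v.
Proof.
move=> c0 sW sV W1 W'c V1 bu sol.
have [v0 v0p w0] := solution_weak_derivative c0 sW sV W1 W'c V1 (Lp_bound_inLp bu) sol.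
pose a := fine (Lpnorm p v0).
have a0 : 0 <= a by rewrite fine_ge0// Lpnorm_ge0.
have iter_ n : exists2 v, Lp_bound p v (a / 2 ^+ n + 9) & weak_derivative u v.
  elim: n => [|n [v bv wv]].
    exists v0 => //; apply: Lp_bound_le (inLp_Lp_bound v0p).
    by rewrite expr0 divr1 lerDl.
  have [v' bv' wv'] := weak_derivative_improve sW sV W1 V1 sol bu bv wv.
  exists v' => //; apply: Lp_bound_le bv'.
  rewrite exprS invfM; lra.
have [n an] : exists n : nat, a < n%:R by exists (Num.truncn a).+1; exact: truncnS_gt.
have [v bv wv] := iter_ n.
exists v => //; apply: Lp_bound_le bv.
suff : a / 2 ^+ n <= 1 by lra.
rewrite ler_pdivrMr ?exprn_gt0// mul1r; apply: ltW; apply: lt_le_trans an _.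
by rewrite -natrX ler_nat ltnW// ltn_expl.
Qed.

End solution.

(** The n-th approximation [D n] has the right values up to index n + 1; the
    locality of [F] makes the diagonal a solution. *)
Lemma exists_two_step_rec (T : Type) (a b : T) (F : (nat -> T) -> nat -> T) :
  (forall d d' n, (forall k, (k <= n.+1)%N -> d k = d' k) -> F d n = F d' n) ->
  exists d, [/\ d 0%N = a, d 1%N = b & forall n, d n.+2 = F d n].
Proof.
move=> Floc.
pose fix D n : nat -> T :=
  if n is m.+1 then fun k => if (k <= m.+1)%N then D m k else F (D m) m
  else fun k => if k is 0 then a else b.
have DS n k : (k <= n.+1)%N -> D n.+1 k = D n k by move=> kn /=; rewrite kn.
have Dst n k : (k <= n.+1)%N -> D n k = D k k.
  move=> kn; have [nk|kn'] := leqP k n.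
    rewrite -(subnKC nk); elim: (n - k)%N => [|m IH]; first by rewrite addn0.
    by rewrite addnS DS// (leq_trans (leq_addr m k)).
  have -> : k = n.+1 by apply/eqP; rewrite eqn_leq kn kn'.
  by rewrite DS.
exists (fun k => D k k); split => // n.
have -> : D n.+2 n.+2 = D n.+1 n.+2 by rewrite DS.
by rewrite /= ltnn; apply: Floc => k kn; exact: Dst.
Qed.

(** The induction step of Leibniz' rule: splitting each term by the product rule
    and collecting by Pascal's identity. *)
Lemma leibniz_pascal (K : comPzRingType) (A F : nat -> K) (n : nat) :
  \sum_(k < n.+2) 'C(n.+1, k)%:R * A (n.+1 - k)%N * F k =
  \sum_(k < n.+1) 'C(n, k)%:R * (A (n - k).+1 * F k + A (n - k)%N * F k.+1).
Proof.
under [RHS]eq_bigr do rewrite mulrDr !mulrA.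
rewrite big_split /= [LHS]big_ord_recl /= bin0 subn0.
under eq_bigr do rewrite /bump leq0n add1n binS subSS natrD !mulrDl.
rewrite big_split /= addrA; congr (_ + _).
have -> : \sum_(k < n.+1) 'C(n, k)%:R * A (n - k).+1 * F k =
    \sum_(k < n.+2) 'C(n, k)%:R * A (n.+1 - k)%N * F k.
  rewrite [RHS]big_ord_recr /= bin_small// !mul0r addr0.
  by apply: eq_bigr => k _; rewrite subSn// -ltnS.
by rewrite [RHS]big_ord_recl /= bin0 subn0.
Qed.

Section higher_derivatives.
Context {R : realType} (p : \bar R) (p1 : (1 <= p)%E).
Local Open Scope complex_scope.
Implicit Types (f g a u v W V phi psi : R -> R[i]).

(** The [n]-th derivative of [a * f 0] when each [f k.+1] is the derivative of
    [f k]. *)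
Definition leibniz a (f : nat -> R -> R[i]) (n : nat) : R -> R[i] :=
  fun x => \sum_(k < n.+1) 'C(n, k)%:R * (cderiven (n - k) a x * f k x).

Lemma Lp_bound_leibniz (c : R) a (f : nat -> R -> R[i]) (r : nat -> R) n :
  0 <= c -> smooth a -> (forall m x, modulus (cderiven m a x) <= c ^+ m) ->
  (forall k, (k <= n)%N -> Lp_bound p (f k) (r k)) ->
  Lp_bound p (leibniz a f n) (\sum_(k < n.+1) 'C(n, k)%:R * (c ^+ (n - k) * r k)).
Proof.
move=> c0 sa ac fr.
apply: (@Lp_bound_sum _ _ p1 n.+1
  (fun k x => 'C(n, k)%:R * (cderiven (n - k) a x * f k x))
  (fun k => 'C(n, k)%:R * (c ^+ (n - k) * r k))) => k kn.
rewrite -[X in X * (_ * r k)](@modulus_nat R); apply: (Lp_boundZ p1).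
apply: (Lp_boundM p1) => //; last exact: fr.
- by apply: smooth_cmeasurable; exact: smooth_cderiven.
- exact: exprn_ge0.
Qed.

Lemma weak_derivative_leibniz (c : R) a (f : nat -> R -> R[i]) n :
  0 <= c -> smooth a -> (forall m x, modulus (cderiven m a x) <= c ^+ m) ->
  (forall k, (k <= n.+1)%N -> inLp p (f k)) ->
  (forall k, (k <= n)%N -> weak_derivative (f k) (f k.+1)) ->
  weak_derivative (leibniz a f n) (leibniz a f n.+1).
Proof.
move=> c0 sa ac fp wf.
pose G k x := 'C(n, k)%:R *
  (cderiven (n - k).+1 a x * f k x + cderiven (n - k) a x * f k.+1 x).
have -> : leibniz a f n.+1 = fun x => \sum_(k < n.+1) G k x.
  apply/funext => x; rewrite /leibniz.
  under eq_bigr do rewrite mulrA.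
  exact: (leibniz_pascal (fun m => cderiven m a x) (f^~ x) n).
have [] // := @weak_derivative_sum _ _ p1 n.+1
  (fun k x => 'C(n, k)%:R * (cderiven (n - k) a x * f k x)) G.
move=> k; rewrite ltnS => kn.
have fk := fp _ (leqW kn); have fk1 : inLp p (f k.+1) by exact: fp.
have cn m : 0 <= c ^+ m by exact: exprn_ge0.
have sm m := smooth_cmeasurable (smooth_cderiven m sa).
have b1 := Lp_boundM p1 (sm (n - k)%N) (cn _) (ac _) (inLp_Lp_bound fk).
have b2 := Lp_boundM p1 (sm (n - k).+1) (cn _) (ac _) (inLp_Lp_bound fk).
have b3 := Lp_boundM p1 (sm (n - k)%N) (cn _) (ac _) (inLp_Lp_bound fk1).
have b4 := Lp_boundD p1 b2 b3.
have w : weak_derivative (fun x => cderiven (n - k) a x * f k x)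
   (fun x => cderiven (n - k).+1 a x * f k x + cderiven (n - k) a x * f k.+1 x).
  have := weak_derivativeM p1 (smooth_cderiven (n - k) sa) (cn _) (cn _) (ac _)
    (ac (n - k).+1) fk fk1 (wf _ kn).
  by rewrite cderivenS.
split.
- exact: Lp_bound_inLp (Lp_boundZ p1 _ b1).
- exact: Lp_bound_inLp (Lp_boundZ p1 _ b4).
- move=> phi tp.
  rewrite (dist_ofZl _ p1 (Lp_bound_inLp b1) (test_cbounded (test_cderiven1 tp))).
  by rewrite (dist_ofZl _ p1 (Lp_bound_inLp b4) (test_cbounded tp)) (w _ tp) mulrN.
Qed.

Lemma dist_derivn_weak (d : nat -> R -> R[i]) (u : R -> R[i]) : d 0%N = u ->
  (forall n, weak_derivative (d n) (d n.+1)) ->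
  forall n, dist_eq (dist_derivn n (dist_of u)) (dist_of (d n)).
Proof.
move=> d0 w; elim => [|n IH] phi tp; first by rewrite d0.
rewrite /dist_derivn /= /dist_derive -/(dist_derivn n (dist_of u)).
rewrite (IH _ (test_cderiven1 tp)) (w n _ tp); exact: opprK.
Qed.

End higher_derivatives.

Theorem theorem1p1 (R : realType) (p : \bar R) (hp : (1 <= p)%E) :
  exists K : R, 0 < K /\
  forall (C0 : R) (W V u : R -> R[i]),
    0 < C0 ->
    smooth W -> smooth V ->
    (forall n : nat, (supnorm (cderiven n W) <= (C0 ^+ n)%:E)%E) ->
    (forall n : nat, (supnorm (cderiven n V) <= (C0 ^+ n)%:E)%E) ->
    inLp p u ->
    dist_solution W V u ->
    Lpnorm p u = 1%E ->
    (* [du n] is the L^p function representing the n-th distributional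
       derivative of u; it is unique up to a null set. *)
    exists du : nat -> R -> R[i],
      (forall n : nat, inLp p (du n) /\
         dist_eq (dist_derivn n (dist_of u)) (dist_of (du n))) /\
      forall kappa : R, 1 < kappa ->
      forall n : nat,
        (Lpnorm p (du n) <=
          ((kappa * C0 + K * (1 / ln kappa + 1)) ^+ n *
            (n`!%:R / (ln (n%:R + expR 1)) ^+ n))%:E)%E.
Proof.
exists (30 * expR 1); split; first by rewrite mulr_gt0 ?expR_gt0.
move=> C0 W V u C00 sW sV hW hV up sol u1.
have c0 := ltW C00.
have mW m x : modulus (cderiven m W x) <= C0 ^+ m by exact: modulus_le_supnorm.
have mV m x : modulus (cderiven m V x) <= C0 ^+ m by exact: modulus_le_supnorm.
have E0 (f : R -> R[i]) : cderiven 0 f = f.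
  by apply/funext => x; rewrite /cderiven /ReF /ImF /=; case: (f x).
have W1 x : modulus (W x) <= 1 by have := mW 0%N x; rewrite E0 expr0.
have V1 x : modulus (V x) <= 1 by have := mV 0%N x; rewrite E0 expr0.
have bu : Lp_bound p u 1 by split; [exact: up.1|rewrite u1].
have [v bv wuv] := solution_weak_derivative_bounded hp c0 sW sV W1 (mW 1%N) V1 bu sol.
pose F (d : nat -> R -> R[i]) n x :=
  leibniz W (fun k => d k.+1) n x + leibniz V d n x.
have [d [d0 d1 dS]] : exists d, [/\ d 0%N = u, d 1%N = v & forall n, d n.+2 = F d n].
  apply: exists_two_step_rec => d d' n dd; apply/funext => x; rewrite /F /leibniz.
  by congr (_ + _); apply: eq_bigr => k _; rewrite dd// leqW// -ltnS.
have bF n (r : nat -> R) : (forall k, (k <= n.+1)%N -> Lp_bound p (d k) (r k)) ->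
    Lp_bound p (d n.+2)
      (\sum_(k < n.+1) 'C(n, k)%:R * C0 ^+ (n - k) * (r k.+1 + r k)).
  move=> dr; rewrite dS.
  under eq_bigr do rewrite mulrDr -!mulrA.
  rewrite big_split; apply: (Lp_boundD hp).
  - apply: (@Lp_bound_leibniz _ _ hp C0 W (fun k => d k.+1) (fun k => r k.+1)) => //.
    by move=> k kn; exact: dr.
  - apply: (@Lp_bound_leibniz _ _ hp C0 V d r) => //.
    by move=> k kn; apply: dr; exact: leqW.
have dp n : inLp p (d n).
  elim/ltn_ind: n => -[|[|n]] IH; first by rewrite d0.
    by rewrite d1; exact: Lp_bound_inLp bv.
  apply: Lp_bound_inLp (bF n (fun k => fine (Lpnorm p (d k))) _) => k kn.
  by apply: inLp_Lp_bound; exact: IH.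
have dw n : weak_derivative (d n) (d n.+1).
  elim/ltn_ind: n => -[|[|n]] IH; first by rewrite d0 d1.
    move=> phi tp; rewrite dS d1.
    have tp' := test_cderiven1 tp.
    have -> : F d 0%N = (fun x => W x * v x + V x * u x).
      apply/funext => x; rewrite /F /leibniz !big_ord_recl !big_ord0 /= d0 d1.
      by rewrite !E0 !mul1r !addr0.
    have bWv := Lp_boundM hp (smooth_cmeasurable sW) ler01 W1 bv.
    have bVu := Lp_boundM hp (smooth_cmeasurable sV) ler01 V1 bu.
    rewrite (dist_ofDl hp (Lp_bound_inLp bWv) (Lp_bound_inLp bVu) (test_cbounded tp)).
    rewrite !dist_of_mul.
    have := wuv _ tp'; rewrite (dist_solutionE sol tp) wuv; last exact: testM.
    by rewrite opprK => /eqP; rewrite -eqr_oppLR => /eqP <-.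
  have IHk k : (k <= n.+1)%N -> weak_derivative (d k) (d k.+1).
    by move=> kn; exact: IH.
  have bL (a : R -> R[i]) m : smooth a ->
      (forall m x, modulus (cderiven m a x) <= C0 ^+ m) ->
      inLp p (leibniz a d m) /\ inLp p (leibniz a (fun k => d k.+1) m).
    move=> sa ha; split.
    + exact: Lp_bound_inLp (@Lp_bound_leibniz _ _ hp C0 a d
        (fun k => fine (Lpnorm p (d k))) m c0 sa ha (fun k _ => inLp_Lp_bound (dp k))).
    + exact: Lp_bound_inLp (@Lp_bound_leibniz _ _ hp C0 a (fun k => d k.+1)
        (fun k => fine (Lpnorm p (d k.+1))) m c0 sa ha
        (fun k _ => inLp_Lp_bound (dp k.+1))).
  rewrite !dS; apply: (weak_derivativeD hp).
  - exact: (bL W n sW mW).2.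
  - exact: (bL W n.+1 sW mW).2.
  - exact: (bL V n sV mV).1.
  - exact: (bL V n.+1 sV mV).1.
  - apply: (weak_derivative_leibniz hp c0) => // k kn.
    by apply: IHk.
  - apply: (weak_derivative_leibniz hp c0) => // k kn.
    by apply: IHk; exact: leqW.
exists d; split; first by move=> n; split; [exact: dp|exact: dist_derivn_weak].
move=> kappa k1 n; rewrite -fineK_Lpnorm// lee_fin.
apply: (@growth_estimate R C0 kappa (fun n => fine (Lpnorm p (d n)))) => //.
- by move=> m; rewrite fine_ge0// Lpnorm_ge0.
- by rewrite d0 u1.
- by rewrite d1; exact: Lp_bound_fine bv.
- move=> m; apply: Lp_bound_fine.
  by apply: (bF m (fun n => fine (Lpnorm p (d n)))) => k _; exact: inLp_Lp_bound.
Qed.
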